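(* Let $K$ be a field of characteristic $0$ and let $k\geq 3$ be an integer. There are polynomials $R(n),S(n)\in\mathbb{Q}[n]$ with $\deg R(n)=2k-2$ and $\deg S(n)\leq 2k-1$ such that for all $n\geq 2k+1$, $$c_n(\mathfrak{N}_{2k+1})\geq c_n(\mathfrak{N}_{2k})\geq 2^nR(n)+S(n),$$ where, when $k\geq 4$, the leading coefficient of $R(n)$ is $$\frac{2^{2k-3}+C_k}{2^{2k-2}(2k-2)!},$$ and, when $k=3$, the leading coefficient of $R(n)$ is $$\frac{2^{2k-3}+C_{k-1}}{2^{2k-2}(2k-2)!}.$$ For $n\leq 2k$, we have $c_n(\mathfrak{N}_{2k+1})=c_n(\mathfrak{N}_{2k})=\dim P_n=n!$. Furthermore, for $2k+1\leq n\leq 4k$, $c_n(\mathfrak{N}_{2k+1})$ is strictly bigger than $c_n(\mathfrak{N}_{2k})$.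
   Context: $C_k=\frac{1}{k+1}\binom{2k}{k}$ is the $k$-th Catalan number. $K\langle X\rangle$ is the free unital associative $K$-algebra on $X=\{x_1,x_2,\dots\}$ and $K\langle X_n\rangle$ the free unital subalgebra generated by $x_1,\dots,x_n$. Commutators are left-normed: $[u_1,u_2]=u_1u_2-u_2u_1$, $[u_1,\dots,u_{m+1}]=[[u_1,\dots,u_m],u_{m+1}]$. $I_{p+1}$ is the two-sided ideal of $K\langle X\rangle$ generated by all commutators $[u_1,\dots,u_{p+1}]$, $u_i\in K\langle X\rangle$. $\mathfrak{N}_p$ is the variety of unital associative $K$-algebras satisfying $[x_1,\dots,x_{p+1}]=0$, and $F_n(\mathfrak{N}_p)=K\langle X_n\rangle/(I_{p+1}\cap K\langle X_n\rangle)$. $P_n\subset K\langle X_n\rangle$ is the space of multilinear polynomials of degree $n$ in $x_1,\dots,x_n$, $P_n(\mathfrak{N}_p)$ is its image in $F_n(\mathfrak{N}_p)$, and $c_n(\mathfrak{N}_p)=\dim P_n(\mathfrak{N}_p)$. *)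

(* Defs.v *)
From HB Require Import structures.
From mathcomp Require Import all_boot all_order all_algebra.
From mathcomp Require Import boolp classical_sets finmap.
From mathcomp Require Import monalg.

Set Implicit Arguments.
Unset Strict Implicit.
Unset Printing Implicit Defensive.

Import Order.TTheory GRing.Theory Num.Theory.
Local Open Scope ring_scope.
Local Open Scope quotient_scope.

Definition catalan (k : nat) : rat := 'C(2 * k, k)%:R / k.+1%:R.

Section Dimension.
Variables (K : fieldType) (V : lmodType K).
Implicit Type W : set V.

Definition is_basis W d (b : 'I_d -> V) : Prop :=
  [/\ forall i, W (b i),
      forall c : 'I_d -> K, \sum_i c i *: b i = 0 -> forall i, c i = 0
    & forall v, W v -> exists c : 'I_d -> K, v = \sum_i c i *: b i].

Definition has_dim W d : Prop := exists b : 'I_d -> V, is_basis W b.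

(* The value is 0 when W has no finite basis. *)
Definition lmdim W : nat := xget 0%N [set d | has_dim W d].

Lemma has_dim_le W d e : has_dim W d -> has_dim W e -> (d <= e)%N.
Proof.
move=> [b [bW bfree _]] [b' [_ _ bspan]].
have /choice [c Ec] i : exists c : 'I_e -> K, b i = \sum_j c j *: b' j.
  exact: bspan.
pose M : 'M[K]_(d, e) := \matrix_(i, j) c i j.
suff /eqP <- : row_free M by apply: rank_leq_col.
rewrite -kermx_eq0; apply/eqP/row_matrixP => r; rewrite row0.
set u := row r _; have uM : u *m M = 0.
  by apply/sub_kermxP; rewrite row_sub.
apply/rowP => i; rewrite [RHS]mxE; move: i; apply: (bfree (fun i => u 0 i)).
under eq_bigr => j _ do rewrite Ec scaler_sumr.
rewrite exchange_big big1 //= => j _.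
under eq_bigr => l _ do rewrite scalerA.
rewrite -scaler_suml.
have /rowP /(_ j) := uM; rewrite !mxE => E.
rewrite [X in X *: _](_ : _ = 0) ?scale0r // -[RHS]E.
by apply: eq_bigr => l _; rewrite [M _ _]mxE.
Qed.

Lemma lmdimE W d : has_dim W d -> lmdim W = d.
Proof.
move=> Wd; apply/eqP; rewrite /lmdim; case: xgetP => [e _ We | /(_ d) //].
by rewrite eqn_leq (has_dim_le Wd We) (has_dim_le We Wd).
Qed.

End Dimension.

Section LmodQuotient.
Variables (K : fieldType) (V : lmodType K) (I : submodClosed V).

(* [submodClosed] does not carry the closure under opposites that
   [Quotient.quot] requires. *)
Definition lquot_pred : {pred V} := fun v => v \in I.

Fact lquot_zmod_closed : zmod_closed lquot_pred.
Proof. exact: GRing.submod_closedB (submodClosedP I). Qed.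
HB.instance Definition _ :=
  GRing.isZmodClosed.Build V lquot_pred lquot_zmod_closed.

Definition lquot : Type := {ideal_quot lquot_pred}.
HB.instance Definition _ := GRing.Zmodule.on lquot.

Definition lproj (v : V) : lquot := \pi_({ideal_quot lquot_pred}) v.

Lemma lprojP u v : lproj u = lproj v <-> u - v \in I.
Proof.
by split=> [/eqP|uv]; [|apply/eqP]; rewrite -Quotient.idealrBE.
Qed.

Definition lquot_scale (a : K) (x : lquot) : lquot :=
  lproj (a *: repr (x : {ideal_quot lquot_pred})).

Lemma lprojD : {morph lproj : u v / u + v}.
Proof. exact: raddfD. Qed.

Lemma lprojZ a v : lproj (a *: v) = lquot_scale a (lproj v).
Proof.
apply/lprojP; rewrite -scalerBr rpredZ //.
by apply/lprojP; rewrite /lproj reprK.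
Qed.

Lemma lproj_surj (x : lquot) : exists v, x = lproj v.
Proof. by exists (repr (x : {ideal_quot lquot_pred})); rewrite /lproj reprK. Qed.

Fact lquot_scaleA a b x :
  lquot_scale a (lquot_scale b x) = lquot_scale (a * b) x.
Proof. by have [v ->] := lproj_surj x; rewrite -!lprojZ scalerA. Qed.
Fact lquot_scale1 : left_id 1 lquot_scale.
Proof. by move=> x; have [v ->] := lproj_surj x; rewrite -lprojZ scale1r. Qed.
Fact lquot_scaleDr : right_distributive lquot_scale +%R.
Proof.
move=> a x y; have [u ->] := lproj_surj x; have [v ->] := lproj_surj y.
by rewrite -lprojD -!lprojZ scalerDr lprojD.
Qed.
Fact lquot_scaleDl x : {morph lquot_scale^~ x : a b / a + b}.
Proof.
by move=> a b; have [v ->] := lproj_surj x; rewrite -!lprojZ scalerDl lprojD.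
Qed.
HB.instance Definition _ := GRing.Zmodule_isLmodule.Build K lquot
  lquot_scaleA lquot_scale1 lquot_scaleDr lquot_scaleDl.

End LmodQuotient.

Section Ideals.
Variable A : nzRingType.

Definition rcommutator (u v : A) : A := u * v - v * u.

(* lcomm u [:: v1; ...; vm] is [u, v1, ..., vm], of length m + 1. *)
Definition lcomm (u : A) (vs : seq A) : A := foldl rcommutator u vs.

Inductive ideal_gen (G : set A) : set A :=
  | ideal_gen_in a of G a : ideal_gen G a
  | ideal_gen0 : ideal_gen G 0
  | ideal_genD a b of ideal_gen G a & ideal_gen G b : ideal_gen G (a + b)
  | ideal_genMl a b of ideal_gen G b : ideal_gen G (a * b)
  | ideal_genMr a b of ideal_gen G a : ideal_gen G (a * b).

Definition comm_ideal (m : nat) : set A :=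
  ideal_gen [set a | exists u vs, (size vs).+1 = m /\ a = lcomm u vs].

End Ideals.

Section FreeAlgebra.
Variable K : fieldType.

(* The letter i stands for x_(i+1). *)
Definition freealg : Type := {malg K[{fmonom nat}]}.
HB.instance Definition _ := GRing.Lalgebra.on freealg.

Section Subalgebra.
Variable n : nat.

Definition freealgn_pred : {pred freealg} := fun a =>
  all (fun w : {fmonom nat} => all (fun i => i < n)%N w) (msupp a).

Fact freealgn_submod : submod_closed freealgn_pred.
Proof.
rewrite /freealgn_pred; split=> [|c a b]; rewrite !unfold_in.
  by rewrite msupp0.
move=> /allP Ha /allP Hb; apply/allP => w /(fsubsetP (msuppD_le _ _)).
rewrite inE => /orP [/(fsubsetP (msuppZ_le _ _)) | ]; [exact: Ha | exact: Hb].
Qed.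
HB.instance Definition _ :=
  GRing.isSubmodClosed.Build K freealg freealgn_pred
    (GRing.submod_closed_semi freealgn_submod).

Record freealgn := FreeAlgN
  { freealgn_val :> freealg; freealgn_valP : freealgn_val \in freealgn_pred }.
HB.instance Definition _ := [isSub for freealgn_val].
HB.instance Definition _ := [Choice of freealgn by <:].
HB.instance Definition _ := [SubChoice_isSubLmodule of freealgn by <:].

(* The multilinear polynomials of degree n in x_1, ..., x_n. *)
Definition multilin : set freealgn :=
  [set a | forall w : {fmonom nat}, w \in msupp (val a) -> perm_eq w (iota 0 n)].

Variable p : nat.

Definition Tideal_pred : {pred freealgn} :=
  fun a => `[< comm_ideal p.+1 (val a) >].

Fact Tideal_submod : submod_closed Tideal_pred.
Proof.
split=> [|c a b]; rewrite !unfold_in.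
  by apply/asboolP; rewrite raddf0; apply: ideal_gen0.
move=> /asboolP Ia /asboolP Ib; apply/asboolP.
have -> : val (c *: a + b) = (c *: 1) * val a + val b.
  by rewrite linearP -scalerAl mul1r.
by apply: ideal_genD => //; apply: ideal_genMl.
Qed.
HB.instance Definition _ :=
  GRing.isSubmodClosed.Build K freealgn Tideal_pred
    (GRing.submod_closed_semi Tideal_submod).

(* The underlying vector space of F_n(N_p). *)
Definition relfree : lmodType K := lquot Tideal_pred.

Definition relfree_multilin : set relfree :=
  [set lproj Tideal_pred a | a in multilin]%classic.

End Subalgebra.

(* c_n(N_p): the codimension in the sense of PI-theory. *)
Definition nilp_codim (p n : nat) : nat := lmdim (@relfree_multilin n p).

End FreeAlgebra.

Arguments multilin K n : clear implicits.

(* Main.v *)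
(** Functionals on P_n vanishing on I_(2k+1) come from signs of words.  Fix a set A of
    letters and r = k - 1 edges M between letters, and let the sign of a multilinear
    word w be (-1)^N, where N counts the inverted pairs of w lying in A plus those
    joined by an edge.  (These are coordinates of substitutions in the tensor product
    of the Grassmann algebra with r copies of the Grassmann algebra on two generators.)
    Interchanging adjacent subwords u and v multiplies the sign by a factor eps(u, v)
    depending only on their letters, hence the functional maps [u_1, ..., u_m] to
    prod_i (1 - eps(u_1...u_(i-1), u_i)) times the sign of u_1...u_m.  A factor is
    nonzero only if u_i closes an edge, or if u_1...u_(i-1) and u_i both have an odd
    number of letters in A; the latter cannot happen twice in a row and there are only
    r edges, so the product vanishes for m = 2k + 1.

    To see that many of these functionals are independent, evaluate them on products of
    commutators with entries [x, y] (x, y in A), [s, i, j] (i in A, j not in A, ij an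
    edge) and at most one [s, a, b, t] (a, b in A, ab an edge).  Ordering by the number
    of letters used in commutators makes the evaluation matrix triangular.  Counting
    gives 6 r! c_n >= 5 * 2^(n-2r) (n-d)(n-d-1)...(n-d-2r+1) for a constant d, whose
    leading term dominates the required one because 6 (2^(2k-3) + C_k) r! <= 5 (2r)!
    (with C_(k-1) instead of C_k, and equality, for k = 3).

    The remaining claims follow from the degree: after setting some letters equal to 1,
    an element of I_m still has no monomial shorter than m. *)
Require Import Defs.
From HB Require Import structures.
From mathcomp Require Import all_boot all_order all_algebra.
From mathcomp Require Import boolp classical_sets finmap.
From mathcomp Require Import monalg.
From mathcomp Require Import zify ring lra.

Set Implicit Arguments.
Unset Strict Implicit.
Unset Printing Implicit Defensive.

Import Order.TTheory GRing.Theory Num.Theory.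
Local Open Scope ring_scope.

(** * Words and functionals on the free algebra *)

Section Commutators.
Variables (K : fieldType) (A : algType K).
Implicit Types (a b z : A).

Lemma rcommutatorDr z a b :
  rcommutator z (a + b) = rcommutator z a + rcommutator z b.
Proof. by rewrite /rcommutator mulrDr mulrDl opprD addrACA. Qed.

Lemma rcommutatorDl z a b :
  rcommutator (a + b) z = rcommutator a z + rcommutator b z.
Proof. by rewrite /rcommutator mulrDr mulrDl opprD addrACA. Qed.

Lemma rcommutatorZr c z a : rcommutator z (c *: a) = c *: rcommutator z a.
Proof. by rewrite /rcommutator -scalerAr -scalerAl scalerBr. Qed.

Lemma rcommutatorZl c z a : rcommutator (c *: z) a = c *: rcommutator z a.
Proof. by rewrite /rcommutator -scalerAr -scalerAl scalerBr. Qed.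

Lemma lcomm0 (vs : seq A) : lcomm 0 vs = 0.
Proof.
by elim: vs => //= v vs; rewrite /rcommutator mul0r mulr0 subr0.
Qed.

Lemma lcommD (vs : seq A) a b : lcomm (a + b) vs = lcomm a vs + lcomm b vs.
Proof. by elim: vs a b => //= v vs IH a b; rewrite rcommutatorDl IH. Qed.

Lemma lcommZ (vs : seq A) c a : lcomm (c *: a) vs = c *: lcomm a vs.
Proof. by elim: vs a => //= v vs IH a; rewrite rcommutatorZl IH. Qed.

Lemma lcomm_rcons (vs : seq A) v a : lcomm a (rcons vs v) = rcommutator (lcomm a vs) v.
Proof. by rewrite /lcomm -cats1 foldl_cat. Qed.

End Commutators.

Section Generation.
Variables (K : fieldType) (A : algType K) (I : Type) (gen : I -> A).
Hypothesis span_ind : forall P : A -> Prop,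
  P 0 -> (forall a b, P a -> P b -> P (a + b)) ->
  (forall c i, P (c *: gen i)) -> forall a, P a.

(* Commutators are multilinear in their entries. *)
Lemma lcomm_gen_ind (P : A -> Prop) m :
  P 0 -> (forall a b, P a -> P b -> P (a + b)) ->
  (forall c a, P a -> P (c *: a)) ->
  (forall u vs, size vs = m -> P (lcomm (gen u) (map gen vs))) ->
  forall a vs, size vs = m -> P (lcomm a vs).
Proof.
move=> P0 PD PZ PW z vs.
(* Entries are expanded from left to right: [us] holds those already reduced to generators, and the
   head [a] is expanded last. *)
have H us : (size us + size vs = m)%N ->
    forall a, P (lcomm (lcomm a (map gen us)) vs).
  elim: vs us => [|v vs IH] us /=.
    rewrite addn0 => sz u /=; elim/span_ind: u => [|a b Ha Hb|c w].
    - by rewrite /= lcomm0.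
    - by rewrite /= lcommD; apply: PD.
    - by rewrite /= lcommZ; apply: PZ; apply: PW.
  rewrite -addSnnS => sz u /=.
  elim/span_ind: v => [|a b Ha Hb|c w].
  - by rewrite /rcommutator mulr0 mul0r subr0 lcomm0.
  - by rewrite rcommutatorDr lcommD; apply: PD.
  - rewrite rcommutatorZr lcommZ; apply: PZ.
    have := IH (rcons us w); rewrite size_rcons => /(_ sz u).
    by rewrite map_rcons lcomm_rcons.
by move=> sz; apply: (H [::] sz z).
Qed.

Variable phi : A -> K.
Hypothesis phi0 : phi 0 = 0.
Hypothesis phiD : forall a b, phi (a + b) = phi a + phi b.
Hypothesis phiZ : forall c a, phi (c *: a) = c * phi a.

Lemma sandwich_vanish z :
  (forall i j, phi (gen i * z * gen j) = 0) -> forall a b, phi (a * z * b) = 0.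
Proof.
move=> H a b; elim/span_ind: a => [|a a' Ha Ha'|c i].
- by rewrite !mul0r phi0.
- by rewrite !mulrDl phiD Ha Ha' addr0.
rewrite -!scalerAl phiZ; elim/span_ind: b => [|b b' Hb Hb'|d j].
- by rewrite mulr0 phi0 mulr0.
- by rewrite mulrDr phiD mulrDr Hb Hb' addr0.
by rewrite -scalerAr phiZ H !mulr0.
Qed.

Lemma comm_ideal_vanish m :
  (forall u vs, size vs = m -> forall i j,
    phi (gen i * lcomm (gen u) (map gen vs) * gen j) = 0) ->
  forall z, comm_ideal m.+1 z -> phi z = 0.
Proof.
move=> H z Iz.
(* Vanishing is strengthened to all two-sided multiples, a property preserved by the closure rules
   of an ideal. *)
pose Q z := forall a b, phi (a * z * b) = 0; suff: Q z.
  by move/(_ 1 1); rewrite mul1r mulr1.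
elim: Iz => {z} [z [u [vs [[sz] ->]]]||z z' _ IHz _ IHz'|z z' _ IH|z z' _ IH] a b.
- move: a b; apply: (lcomm_gen_ind (P := Q) (m := m))
    => [a b|z1 z2 Hz Hz2 a b|c z1 Hz a b|u1 vs1 sz1|//].
  + by rewrite mulr0 mul0r phi0.
  + by rewrite mulrDr mulrDl phiD Hz Hz2 addr0.
  + by rewrite -scalerAr -scalerAl phiZ Hz mulr0.
  + by apply: sandwich_vanish => i j; apply: H.
- by rewrite mulr0 mul0r phi0.
- by rewrite mulrDr mulrDl phiD IHz IHz' addr0.
- by rewrite mulrA IH.
- by rewrite mulrA -mulrA IH.
Qed.

End Generation.

Section FreeAlgebraScaling.
Variable K : fieldType.

(** Centrality of the scalars upgrades the free algebra to an [algType], the setting of the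
    preceding lemmas. *)
Fact freealg_scalerAr (c : K) (a b : {malg K[{fmonom nat}]}) :
  c *: (a * b) = a * (c *: b).
Proof.
have comm : a * c%:MP = c *: a.
  rewrite malgM_def fgmulgU malgZ_def; apply: eq_bigr => m _.
  by rewrite mulm1 mulrC.
by rewrite -[c *: b]mul_malgC [RHS]mulrA comm -scalerAl.
Qed.

HB.instance Definition _ :=
  GRing.Lalgebra_isAlgebra.Build K (freealg K) freealg_scalerAr.

End FreeAlgebraScaling.

Section Words.
Variable K : fieldType.
Implicit Types (a b z : freealg K) (u v w : seq nat).

Definition word w : freealg K := << FMonom w >>.

Lemma word_cat u v : word (u ++ v) = word u * word v.
Proof.
rewrite /word malgM_def fgmulUU mulr1; congr (<< _ >>).
by apply/eqP; rewrite fmP fmM.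
Qed.

Lemma word_nil : word [::] = 1.
Proof.
apply/malgP => m; rewrite mcoeff1 /word mcoeffU1 eq_sym; congr (_ %:R).
by congr (_ == _); apply/eqP; rewrite fmP fm1.
Qed.

Lemma word_coef u (m : {fmonom nat}) : (word u)@_m = (u == m)%:R.
Proof. by rewrite mcoeffU1 fmP. Qed.

Lemma word_ind (P : freealg K -> Prop) :
  P 0 -> (forall a b, P a -> P b -> P (a + b)) ->
  (forall (c : K) w, P (c *: word w)) -> forall a, P a.
Proof.
move=> P0 PD PW a; rewrite [a]monalgE; elim/big_ind: _ => // m _.
have -> : << a@_m *g m >> = a@_m *: word m; last exact: PW.
apply/malgP => m'; rewrite mcoeffZ word_coef mcoeffU.
by rewrite eq_sym -fmP eq_sym mulr_natr.
Qed.

Definition lin_ext (phi : seq nat -> K) a : K :=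
  mmap idfun (fun m : {fmonom nat} => phi m) a.

Lemma lin_extD phi a b : lin_ext phi (a + b) = lin_ext phi a + lin_ext phi b.
Proof. exact: mmapD. Qed.

Lemma lin_extN phi a : lin_ext phi (- a) = - lin_ext phi a.
Proof. exact: mmapN. Qed.

Lemma lin_ext0 phi : lin_ext phi 0 = 0.
Proof. exact: mmap0. Qed.

Lemma lin_extZ phi c a : lin_ext phi (c *: a) = c * lin_ext phi a.
Proof.
rewrite /lin_ext (mmapEw (msuppZ_le _ _)) mmapE big_distrr /=.
by apply: eq_bigr => m _; rewrite mcoeffZ mulrA.
Qed.

Lemma lin_ext_word phi w : lin_ext phi (word w) = phi w.
Proof. by rewrite /lin_ext mmapU mul1r. Qed.

Lemma lin_ext_sum phi I (r : seq I) (P : pred I) (F : I -> freealg K) :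
  lin_ext phi (\sum_(i <- r | P i) F i) = \sum_(i <- r | P i) lin_ext phi (F i).
Proof. by apply: (big_morph _ (lin_extD phi) (lin_ext0 phi)). Qed.

Lemma lin_ext_ext phi psi a :
  phi =1 psi -> lin_ext phi a = lin_ext psi a.
Proof. by move=> E; apply: eq_bigr => m _; rewrite E. Qed.

Lemma lin_ext_coef w a : lin_ext (fun v => (v == w)%:R) a = a@_(FMonom w).
Proof.
elim/word_ind: a => [|a b Ha Hb|c v].
- by rewrite lin_ext0 mcoeff0.
- by rewrite lin_extD mcoeffD Ha Hb.
- by rewrite lin_extZ mcoeffZ lin_ext_word word_coef.
Qed.

End Words.

(** * Signed counting of words *)

Section CrossParity.
Variable T : eqType.
Implicit Types (f g : T -> T -> bool) (u v w : seq T).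

(** Parities are booleans under [addb], so [cross] is additive over F_2 in each word and in [f]. *)
Definition cross f u v := \big[addb/false]_(x <- u) \big[addb/false]_(y <- v) f x y.

Fixpoint inv_parity f w :=
  if w is x :: w' then cross f [:: x] w' (+) inv_parity f w' else false.

Lemma cross_nill f v : cross f [::] v = false.
Proof. by rewrite /cross big_nil. Qed.

Lemma cross_catl f u v w : cross f (u ++ v) w = cross f u w (+) cross f v w.
Proof. by rewrite /cross big_cat. Qed.

Lemma cross_catr f u v w : cross f u (v ++ w) = cross f u v (+) cross f u w.
Proof.
rewrite /cross -big_split; apply: eq_bigr => x _.
by rewrite big_cat.
Qed.

Lemma crossC f u v : cross f u v = cross (fun x y => f y x) v u.
Proof. by rewrite /cross exchange_big. Qed.

Lemma crossD f g u v :
  cross (fun x y => f x y (+) g x y) u v = cross f u v (+) cross g u v.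
Proof.
rewrite /cross -big_split; apply: eq_bigr => x _.
by rewrite -big_split.
Qed.

Lemma eq_in_cross f g u v :
  {in u & v, forall x y, f x y = g x y} -> cross f u v = cross g u v.
Proof.
move=> E; rewrite /cross !big_seq; apply: eq_bigr => x xu.
by rewrite !big_seq; apply: eq_bigr => y yv; apply: E.
Qed.

Lemma cross_predI (p : pred T) u v :
  cross (fun x y => p x && p y) u v = odd (count p u) && odd (count p v).
Proof.
have big_count w : \big[addb/false]_(y <- w) p y = odd (count p w).
  elim: w => [|y w IH]; first by rewrite big_nil.
  by rewrite big_cons IH /= oddD; case: (p y).
rewrite /cross; elim: u => [|x u IH]; first by rewrite big_nil.
rewrite big_cons IH /= oddD andb_addl; congr (_ (+) _).
case: (p x) => /=; last by rewrite big1.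
by rewrite -big_count; apply: eq_bigr.
Qed.

Lemma inv_parity_cat f u v :
  inv_parity f (u ++ v) = inv_parity f u (+) inv_parity f v (+) cross f u v.
Proof.
elim: u => [|x u IH] /=; first by rewrite cross_nill addbF.
rewrite IH cross_catr -[x :: u]cat1s cross_catl.
move: (cross f _ u) (cross f _ v) (cross f u v) (inv_parity f u) (inv_parity f v).
by do 5!case.
Qed.

End CrossParity.

Section SignedWords.
Variables (A : pred nat) (M : seq (nat * nat)).
Implicit Types (u v w : seq nat) (vs : seq (seq nat)).

Definition adj x y := ((x, y) \in M) || ((y, x) \in M).

Lemma adjC x y : adj x y = adj y x.
Proof. by rewrite /adj orbC. Qed.

(* The sign acquired when the adjacent letters x and y are interchanged: both are
   Grassmann variables (A), and the ends of an edge of M anticommute once more. *)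
Definition omega x y := (A x && A y) (+) adj x y.

Lemma omegaC x y : omega x y = omega y x.
Proof. by rewrite /omega andbC adjC. Qed.

Lemma cross_omega u v :
  cross omega u v = (odd (count A u) && odd (count A v)) (+) cross adj u v.
Proof. by rewrite /omega crossD cross_predI. Qed.

Definition twist x y := (y < x)%N && omega x y.

(** Of the two orders of a pair of distinct letters exactly one is an inversion, so the two
    crossings together count each related pair once. *)
Lemma cross_twist u v : uniq (u ++ v) ->
  cross twist u v (+) cross twist v u = cross omega u v.
Proof.
rewrite cat_uniq => /and3P [_ /hasPn uv _].
rewrite [cross twist v u]crossC -crossD; apply: eq_in_cross => x y xu yv.
rewrite /twist omegaC; case: (ltngtP y x) => //= [|Exy]; first by rewrite addbF.
by have := uv _ yv; rewrite Exy xu.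
Qed.

Section Values.
Variables (K : pzRingType) (n : nat).

(** The value 0 off the multilinear words matters: the bound on the number of edges inside a word
    holds only when its letters are distinct. *)
Definition sign_fun w : K :=
  if perm_eq w (iota 0 n) then (-1) ^+ inv_parity twist w else 0.

(** Only pairs with one letter in [v] and one in [w] change their order, and [cross_twist] evaluates
    their contribution. *)
Lemma sign_fun_swap u v w x :
  sign_fun (u ++ w ++ v ++ x) = (-1) ^+ cross omega v w * sign_fun (u ++ v ++ w ++ x).
Proof.
rewrite /sign_fun.
have E : perm_eq (u ++ w ++ v ++ x) (u ++ v ++ w ++ x).
  by rewrite perm_cat2l perm_catCA.
rewrite (permPl E); case: ifP => [P|_]; last by rewrite mulr0.
have U : uniq (v ++ w).
  have : uniq (u ++ v ++ w ++ x) by rewrite (perm_uniq P) iota_uniq.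
  rewrite cat_uniq => /and3P [_ _].
  by rewrite catA cat_uniq => /andP [].
rewrite -(cross_twist U) -signr_addb !inv_parity_cat !cross_catr; congr ((-1) ^+ _).
congr (nat_of_bool _).
move: (inv_parity _ u) (inv_parity _ v) (inv_parity _ w) (inv_parity _ x).
move: (cross _ u v) (cross _ u w) (cross _ u x) (cross _ v w) (cross _ v x).
by move: (cross _ w v) (cross _ w x); do 11!case.
Qed.

End Values.

(* Whether no factor 1 - eps vanishes when the commutator [u, v_1, ..., v_m] is
   evaluated from the left. *)
Fixpoint alternating u vs :=
  if vs is v :: vs' then cross omega u v && alternating (u ++ v) vs' else true.

Fixpoint edge_count w :=
  if w is x :: w' then (count (adj x) w' + edge_count w')%N else 0%N.

Lemma edge_count_cat u v :
  (edge_count (u ++ v) =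
   edge_count u + edge_count v + \sum_(x <- u) count (adj x) v)%N.
Proof.
elim: u => [|x u IH] /=; first by rewrite big_nil addn0.
by rewrite IH count_cat big_cons; move: (bigop _ _ _) => s; lia.
Qed.

Lemma edge_count_cross u v : cross adj u v ->
  (edge_count u < edge_count (u ++ v))%N.
Proof.
rewrite edge_count_cat => H.
suff : (0 < \sum_(x <- u) count (adj x) v)%N by move: (bigop _ _ _) => s; lia.
rewrite lt0n; apply: contraL H => /eqP; elim: u => [|x u IH].
  by rewrite cross_nill.
rewrite big_cons => /eqP; rewrite addn_eq0 => /andP [/eqP x0 /eqP /IH u0].
rewrite -cat1s cross_catl (negPf u0) addbF /cross big_seq1 big_seq big1 // => y yv.
apply/negP => xy; move/eqP: x0; rewrite -leqn0 leqNgt -has_count => /hasP.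
by apply; exists y.
Qed.

(* A letter pair enters the commutator with sign -1 either by closing an edge
   of M or because both arguments are odd; the latter leaves an even word, so
   it cannot happen twice in a row. *)
Lemma alternating_bound u vs : alternating u vs ->
  (size vs <= 2 * edge_count (u ++ flatten vs) + 1)%N.
Proof.
(* Here [i] counts the entries already absorbed into [u]. A new edge raises the right side by at
   least 2 and the left by at most 2; without one, [u] turns from odd to even and the left side is
   unchanged. *)
suff H i : (i + odd (count A u) <= 2 * edge_count u + 1)%N -> alternating u vs ->
    (i + size vs <= 2 * edge_count (u ++ flatten vs) + 1)%N.
  by apply: (H 0%N); case: odd; rewrite ?add0n //= addn1.
elim: vs u i => [|v vs IH] u i /=; first by rewrite cats0; lia.
move=> Hi /andP [Hv Halt]; rewrite catA -addSnnS; apply: IH => //.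
move: Hv; rewrite cross_omega count_cat oddD.
have [/edge_count_cross E _|nuv] := boolP (cross adj u v).
  by move: Hi E; case: (odd (count A u)); case: (odd (count A v)) => /=; lia.
rewrite addbF => /andP [ou ov]; move: Hi; rewrite ou ov edge_count_cat /=.
by move: (bigop _ _ _) => s; lia.
Qed.

End SignedWords.

Lemma adj_cons e M x y : adj (e :: M) x y = adj [:: e] x y || adj M x y.
Proof. by rewrite /adj !inE; do 4!case: (_ \in _) || case: (_ == _). Qed.

(** Edge by edge: when letters do not repeat, each edge joins at most one pair of positions. *)
Lemma edge_count_uniq M w : uniq w -> (edge_count M w <= size M)%N.
Proof.
move=> Uw; elim: M => [|e M IH].
  by elim: w {Uw} => //= x w IH; rewrite (eq_count (a2 := pred0)) // count_pred0.
have H : (edge_count (e :: M) w <= edge_count [:: e] w + edge_count M w)%N.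
  elim: w {Uw IH} => //= x w IH.
  suff C : (count (adj (e :: M) x) w <= count (adj [:: e] x) w + count (adj M x) w)%N.
    by rewrite addnACA leq_add.
  rewrite (eq_count (adj_cons e M x)) -count_predUI; apply: leq_addr.
suff : (edge_count [:: e] w <= 1)%N by rewrite /=; lia.
case: e {H IH} => i j; elim: w Uw => //= x w IH /andP [xw Uw].
have adjE y z : adj [:: (i, j)] y z = ((y == i) && (z == j)) || ((z == i) && (y == j)).
  by rewrite /adj !inE !xpair_eqE.
have [Hx|Hx] := boolP ((x == i) || (x == j)); last first.
  rewrite (eq_in_count (a2 := pred0)) ?count_pred0 ?IH // => y _.
  by move: Hx; rewrite adjE negb_or => /andP [/negPf -> /negPf ->]; rewrite andbF.
(* Once the head is an end of the edge, the tail lacks that end and contains no joined pair. *)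
have E0 v : x \notin v -> edge_count [:: (i, j)] v = 0%N.
  elim: v => //= y v IHv; rewrite inE negb_or => /andP [xy xv].
  rewrite IHv // addn0; apply/eqP; rewrite -leqn0 leqNgt -has_count; apply/hasPn => z zv.
  have xz : x != z by apply: contraNneq xv => ->.
  rewrite adjE; apply/negP => H; case/orP: Hx => /eqP Ex; subst x;
    by case/orP: H => /andP [/eqP Ha /eqP Hb]; subst; rewrite ?eqxx in xy xz.
rewrite E0 // addn0.
have Cx a : (count (pred1 a) w <= 1)%N by rewrite count_uniq_mem //; case: (_ \in _).
case/orP: Hx => /eqP Ex; subst x; [have C := Cx j | have C := Cx i].
  rewrite (eq_in_count (a2 := pred1 j)) // => z zw.
  rewrite adjE eqxx /=; have /negPf -> : z != i by apply: contraNneq xw => <-.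
  by rewrite orbF.
rewrite (eq_in_count (a2 := pred1 i)) // => z zw.
rewrite adjE eqxx andbT /=; have /negPf -> : z != j by apply: contraNneq xw => <-.
by rewrite andbF.
Qed.

(** * Products of commutators *)

Section SignedEvaluation.
Variables (K : fieldType) (A : algType K) (gen : seq nat -> A).
Hypothesis gen_nil : gen [::] = 1.
Hypothesis gen_cat : forall u v, gen (u ++ v) = gen u * gen v.
Hypothesis span_ind : forall P : A -> Prop,
  P 0 -> (forall a b, P a -> P b -> P (a + b)) ->
  (forall c w, P (c *: gen w)) -> forall a, P a.
Variable phi : A -> K.
Hypothesis phi0 : phi 0 = 0.
Hypothesis phiD : forall a b, phi (a + b) = phi a + phi b.
Hypothesis phiZ : forall c a, phi (c *: a) = c * phi a.
Variables (p : pred nat) (M : seq (nat * nat)).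
Local Notation om := (omega p M).
Hypothesis phi_swap : forall u v w x,
  phi (gen (u ++ w ++ v ++ x)) =
  (-1) ^+ cross om v w * phi (gen (u ++ v ++ w ++ x)).
Implicit Types (a b z : A) (u v w : seq nat) (vs : seq (seq nat)).

Let phiN a : phi (- a) = - phi a.
Proof. by apply/eqP; rewrite -subr_eq0 opprK -phiD addNr phi0. Qed.

(* phi sees z only as the multiple c of the word w. *)
Definition collapses z (c : K) w :=
  forall a b, phi (a * z * b) = c * phi (a * gen w * b).

Lemma collapses_gen w : collapses (gen w) 1 w.
Proof. by move=> a b; rewrite mul1r. Qed.

Lemma collapsesM z z' c c' w w' :
  collapses z c w -> collapses z' c' w' -> collapses (z * z') (c * c') (w ++ w').
Proof.
move=> Hz Hz' a b; rewrite gen_cat mulrA -(mulrA (a * z)) Hz mulrA Hz' -!mulrA.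
by rewrite !mulrA.
Qed.

Lemma phi_swap_gen u v a b :
  phi (a * gen (v ++ u) * b) = (-1) ^+ cross om u v * phi (a * gen (u ++ v) * b).
Proof.
elim/span_ind: a => [|a a' Ha Ha'|c x].
- by rewrite !mul0r phi0 mulr0.
- by rewrite !mulrDl !phiD Ha Ha' mulrDr.
rewrite -!scalerAl !phiZ mulrCA; congr (_ * _).
elim/span_ind: b => [|b b' Hb Hb'|d y].
- by rewrite !mulr0 phi0 mulr0.
- by rewrite !mulrDr !phiD Hb Hb' mulrDr.
by rewrite -!scalerAr !phiZ mulrCA -!gen_cat -!catA phi_swap.
Qed.

Lemma alternating_rcons u vs v :
  alternating p M u (rcons vs v) =
  alternating p M u vs && cross om (u ++ flatten vs) v.
Proof.
by elim: vs u => [|v' vs IH] u /=; rewrite ?cats0 ?andbT // IH catA andbA.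
Qed.

(** Bracketing with [v] multiplies the value by 1 - eps, which is 2 or 0 according to the parity of
    the crossing; hence the power of 2. *)
Lemma lcomm_collapses u vs :
  collapses (lcomm (gen u) (map gen vs))
    ((alternating p M u vs)%:R * 2 ^+ size vs) (u ++ flatten vs).
Proof.
elim/last_ind: vs => [|vs v IH] a b /=.
  by rewrite cats0 mul1r expr0 mul1r.
rewrite map_rcons lcomm_rcons /rcommutator mulrBr mulrBl phiD phiN.
rewrite (mulrA a _ (gen v)) -(mulrA (a * _) (gen v) b) IH (mulrA a (gen v)) IH.
rewrite (mulrA _ (gen v) b) -(mulrA a (gen _)) -(mulrA a (gen v)) -!gen_cat.
rewrite (phi_swap_gen (u ++ flatten vs) v) flatten_rcons catA.
rewrite alternating_rcons size_rcons exprS.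
case: (cross _ _ _) => /=; last first.
  by rewrite andbF !mul0r expr0 mul1r subrr.
rewrite andbT expr1 mulN1r mulrN opprK -mulr2n -[LHS]mulr_natr -!mulrA.
by congr (_ * _); rewrite mulrA mulrC.
Qed.

Definition letter_comm w : A :=
  if w is x :: w' then lcomm (gen [:: x]) [seq gen [:: y] | y <- w'] else 1.

Definition good_block w :=
  if w is x :: w' then alternating p M [:: x] [seq [:: y] | y <- w'] else true.

Lemma letter_comm_collapses w :
  collapses (letter_comm w) ((good_block w)%:R * 2 ^+ (size w).-1) w.
Proof.
case: w => [|x w] /=; first by rewrite mul1r expr0 -gen_nil; apply: collapses_gen.
have := lcomm_collapses [:: x] [seq [:: y] | y <- w].
by rewrite -map_comp size_map flatten_seq1.
Qed.

Definition comm_product w (vs : seq (seq nat)) : A :=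
  gen w * \prod_(v <- vs) letter_comm v.

(** The exponent of 2 is left unspecified: in characteristic 0 only the vanishing of the coefficient
    matters. *)
Lemma comm_product_eval w vs : exists e,
  phi (comm_product w vs) = (all good_block vs)%:R * 2 ^+ e * phi (gen (w ++ flatten vs)).
Proof.
suff [e He] : exists e,
    collapses (\prod_(v <- vs) letter_comm v) ((all good_block vs)%:R * 2 ^+ e) (flatten vs).
  exists e; have := He (gen w) 1.
  by rewrite !mulr1 -gen_cat.
elim: vs => [|v vs [e He]].
  by exists 0%N; rewrite big_nil mul1r expr0 -gen_nil; apply: collapses_gen.
exists ((size v).-1 + e)%N; rewrite big_cons /=.
have := collapsesM (letter_comm_collapses v) He.
by rewrite -mulnb natrM exprD mulrACA.
Qed.

(** If no factor vanishes, [alternating_bound] forces more edges inside the word than [M] has, so a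
    letter is repeated and [phi] vanishes anyway. *)
Lemma phi_comm_ideal m :
  (forall w, ~~ uniq w -> phi (gen w) = 0) -> (2 * size M + 1 < m)%N ->
  forall z, comm_ideal m.+1 z -> phi z = 0.
Proof.
move=> nuniq szM; apply: (comm_ideal_vanish span_ind) => // u vs szvs x y.
rewrite lcomm_collapses; case: (boolP (alternating _ _ _ _)) => [alt|_]; last first.
  by rewrite !mul0r.
have nU : ~~ uniq (u ++ flatten vs).
  apply: contraL szM => U; rewrite -leqNgt -szvs.
  apply: leq_trans (alternating_bound alt) _.
  by have := edge_count_uniq M U; lia.
rewrite -!gen_cat nuniq ?mulr0 //.
by move: nU; apply: contra; rewrite cat_uniq => /andP [+ _]; rewrite cat_uniq => /and3P [].
Qed.

End SignedEvaluation.

Section SignFunctional.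
Variables (K : fieldType) (p : pred nat) (M : seq (nat * nat)) (n : nat).

Definition sign_ext : freealg K -> K := lin_ext (sign_fun p M K n).

Lemma sign_ext_comm_ideal m : (2 * size M + 1 < m)%N ->
  forall z, comm_ideal m.+1 z -> sign_ext z = 0.
Proof.
refine (@phi_comm_ideal K _ (@word K) _ _ sign_ext _ _ _ p M _ m _).
- exact: word_cat.
- exact: word_ind.
- exact: lin_ext0.
- exact: lin_extD.
- exact: lin_extZ.
- by move=> u v w x; rewrite /sign_ext !lin_ext_word sign_fun_swap.
move=> w nw; rewrite /sign_ext lin_ext_word /sign_fun; case: ifP => // /perm_uniq U.
by rewrite U iota_uniq in nw.
Qed.

Lemma sign_ext_comm_product w vs : exists e,
  sign_ext (comm_product (@word K) w vs) =
  (all (good_block p M) vs)%:R * 2 ^+ e * sign_fun p M K n (w ++ flatten vs).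
Proof.
have swap u v x y : sign_ext (word K (u ++ x ++ v ++ y)) =
    (-1) ^+ cross (omega p M) v x * sign_ext (word K (u ++ v ++ x ++ y)).
  by rewrite /sign_ext !lin_ext_word sign_fun_swap.
have [e ->] := @comm_product_eval K _ (@word K) (@word_nil K) (@word_cat K)
  (@word_ind K) sign_ext (@lin_ext0 K _) (@lin_extD K _) (@lin_extZ K _) p M swap w vs.
by exists e; rewrite /sign_ext lin_ext_word.
Qed.

End SignFunctional.

(** * Codimensions and independent families *)

Section FreeFamilies.
Variables (K : fieldType) (V : lmodType K).
Implicit Types (W : set V).

Definition lfree d (b : 'I_d -> V) :=
  forall c : 'I_d -> K, \sum_i c i *: b i = 0 -> forall i, c i = 0.

Lemma lfree_le d e (b : 'I_d -> V) (g : 'I_e -> V) :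
  lfree b -> (forall i, exists c : 'I_e -> K, b i = \sum_j c j *: g j) -> (d <= e)%N.
Proof.
move=> bfree /choice [c Ec]; pose M := \matrix_(i, j) c i j.
suff /eqP <- : row_free M by apply: rank_leq_col.
apply/inj_row_free => u uM; apply/rowP => i; rewrite [RHS]mxE.
apply: (bfree (u 0)) i; under eq_bigr => i _ do rewrite Ec scaler_sumr.
rewrite exchange_big big1 // => j _; under eq_bigr => i _ do rewrite scalerA.
rewrite -scaler_suml; have /rowP /(_ j) := uM; rewrite !mxE.
under eq_bigr => i _ do rewrite mxE.
by move=> ->; rewrite scale0r.
Qed.

(** Since [lmdim] is 0 without a finite basis, one has to be produced. A longest free family in [W]
    works: [g] bounds its length, and a vector outside its span would extend it. *)
Lemma has_dim_span W m (g : 'I_m -> V) :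
  (forall v, W v -> exists c : 'I_m -> K, v = \sum_j c j *: g j) ->
  exists d, has_dim W d.
Proof.
move=> gspan; pose P d := `[< exists b : 'I_d -> V, (forall i, W (b i)) /\ lfree b >].
have P0 : exists d, P d.
  by exists 0%N; apply/asboolP; exists (fun=> 0); split=> [[]|c _ []].
have Pm d : P d -> (d <= m)%N.
  by move=> /asboolP [b [bW /lfree_le]]; apply=> i; apply: gspan.
case: (ex_maxnP P0 Pm) => d /asboolP [b [bW bfree]] dmax.
exists d, b; split=> // v Wv; apply: contrapT => nspan.
suff /dmax : P d.+1 by rewrite ltnn.
apply/asboolP; exists (fun i => if unlift ord0 i is Some j then b j else v).
split=> [i|c]; first by case: (unlift _ _).
rewrite big_ord_recl unlift_none; under eq_bigr => j _ do rewrite liftK.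
move=> Ec; have c0 : c ord0 = 0.
  apply: contrapT => /eqP nz; apply: nspan.
  exists (fun j => - (c ord0)^-1 * c (lift ord0 j)).
  under eq_bigr => j _ do rewrite -scalerA.
  rewrite -scaler_sumr; move/eqP: Ec; rewrite addr_eq0 => /eqP /(congr1 (fun x => (c ord0)^-1 *: x)).
  by rewrite scalerA mulVf // scale1r scalerN scaleNr.
move: Ec; rewrite c0 scale0r add0r => /bfree cj i.
by case: (unliftP ord0 i) => [j ->|->].
Qed.

Lemma lfree_lmdim W m (g : 'I_m -> V) d (b : 'I_d -> V) :
  (forall v, W v -> exists c : 'I_m -> K, v = \sum_j c j *: g j) ->
  (forall i, W (b i)) -> lfree b -> (d <= lmdim W)%N.
Proof.
move=> /has_dim_span [e We] bW bfree; rewrite (lmdimE We).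
by case: We => b' [_ _ b'span]; apply: (lfree_le bfree) => i; apply: b'span.
Qed.

End FreeFamilies.

Section Codimension.
Variables (K : fieldType) (n : nat).
Implicit Types (z : freealg K).

Definition multilinear z :=
  forall w : {fmonom nat}, w \in msupp z -> perm_eq w (iota 0 n).

(** The default 0 is harmless: only multilinear elements are embedded this way. *)
Definition in_freealgn z : freealgn K n := insubd 0 z.

Lemma multilinear_in z : multilinear z -> val (in_freealgn z) = z.
Proof.
move=> Mz; apply: insubdK; rewrite unfold_in; apply/allP => w /Mz Pw.
by apply/allP => i; rewrite (perm_mem Pw) mem_iota.
Qed.

Lemma multilinear_word w : perm_eq w (iota 0 n) -> multilinear (word K w).
Proof. by move=> Pw m; rewrite msuppU1 inE => /eqP ->. Qed.

Let words := permutations (iota 0 n).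

Lemma size_words : size words = n`!.
Proof. by rewrite size_permutations ?iota_uniq // size_iota. Qed.

Let word_of (i : 'I_n`!) : seq nat := nth [::] words i.

Lemma word_of_perm i : perm_eq (word_of i) (iota 0 n).
Proof. by rewrite -mem_permutations mem_nth // size_words. Qed.

Lemma word_of_inj i j : (word_of i == word_of j) = (i == j).
Proof. by rewrite nth_uniq ?size_words // permutations_uniq. Qed.

Lemma multilin_expand a : multilin K n a ->
  a = \sum_i (val a)@_(FMonom (word_of i)) *: in_freealgn (word K (word_of i)).
Proof.
move=> Ma; apply: val_inj; rewrite linear_sum /=; apply/malgP => m.
rewrite raddf_sum /=.
under eq_bigr => i _.
  rewrite linearZ /= multilinear_in; last exact: multilinear_word (word_of_perm i).
  rewrite word_coef; over.
have [Pm|nPm] := boolP (perm_eq m (iota 0 n)).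
  have lt_m : (index (m : seq nat) words < n`!)%N.
    by rewrite -size_words index_mem mem_permutations.
  have Em : word_of (Ordinal lt_m) = m by rewrite /word_of nth_index // mem_permutations.
  rewrite (bigD1 (Ordinal lt_m)) //= Em eqxx mulr1 fmK big1 ?addr0 // => i ne.
  by rewrite -Em word_of_inj (negPf ne) mulr0.
rewrite (mcoeff_outdom (k := m)); last by apply: contra nPm; apply: Ma.
rewrite big1 // => i _; case: eqP => [E|]; last by rewrite mulr0.
by rewrite -E word_of_perm in nPm.
Qed.

Lemma multilin_in z : multilinear z -> multilin K n (in_freealgn z).
Proof. by move=> Mz w; rewrite multilinear_in //; apply: Mz. Qed.

Lemma coef_sum_words (c : 'I_n`! -> K) (m : {fmonom nat}) :
  (\sum_i c i *: word K (word_of i))@_m = \sum_i c i * (word_of i == m)%:R.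
Proof.
rewrite raddf_sum; apply: eq_bigr => i _.
transitivity (c i * (word K (word_of i))@_m); last by rewrite word_coef.
exact: mcoeffZ.
Qed.

Lemma words_free (c : 'I_n`! -> K) :
  \sum_i c i *: word K (word_of i) = 0 -> forall i, c i = 0.
Proof.
move=> E i; have := congr1 (mcoeff (FMonom (word_of i))) E.
rewrite coef_sum_words mcoeff0 (bigD1 i) //= eqxx mulr1.
rewrite big1 ?addr0 // => j ne; by rewrite word_of_inj (negPf ne) mulr0.
Qed.

Lemma val_sum_words (c : 'I_n`! -> K) :
  val (\sum_i c i *: in_freealgn (word K (word_of i))) =
  \sum_i c i *: word K (word_of i).
Proof.
rewrite linear_sum; apply: eq_bigr => i _; rewrite linearZ /=.
by rewrite multilinear_in //; apply: multilinear_word; apply: word_of_perm.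
Qed.

Lemma lmdim_multilin : lmdim (multilin K n) = n`!.
Proof.
apply: lmdimE; exists (fun i => in_freealgn (word K (word_of i))); split.
- by move=> i; apply: multilin_in; apply: multilinear_word; apply: word_of_perm.
- move=> c E; apply: words_free; rewrite -val_sum_words E; exact: linear0.
- by move=> a Ma; exists (fun i => (val a)@_(FMonom (word_of i))); apply: multilin_expand.
Qed.

Variable p : nat.
Let proj := lproj (Tideal_pred (K := K) (n := n) p).

Let proj_sum (I : finType) (c : I -> K) (a : I -> freealgn K n) :
  \sum_i c i *: proj (a i) = proj (\sum_i c i *: a i).
Proof.
rewrite /proj (big_morph _ (@lprojD K _ _) (_ : proj 0 = 0)); last exact: raddf0.
by apply: eq_bigr => i _; rewrite lprojZ.
Qed.

Lemma proj_words v : relfree_multilin (K := K) (n := n) (p := p) v ->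
  exists c : 'I_n`! -> K, v = \sum_j c j *: proj (in_freealgn (word K (word_of j))).
Proof.
case=> a Ma <-; exists (fun i => (val a)@_(FMonom (word_of i))).
by rewrite proj_sum -multilin_expand.
Qed.

(** Independence in the quotient, phrased upstairs so that functionals on the free algebra apply
    directly. *)
Definition indep_mod (I : finType) (z : I -> freealg K) :=
  forall c : I -> K, comm_ideal p.+1 (\sum_i c i *: z i) -> forall i, c i = 0.

Let proj_eq0 (a : freealgn K n) : proj a = 0 <-> comm_ideal p.+1 (val a).
Proof.
have <- : proj 0 = 0 by exact: raddf0.
rewrite /proj lprojP subr0; split; first by move=> H; apply/asboolP.
by move=> H; apply/asboolP.
Qed.

Lemma indep_codim (I : finType) (z : I -> freealg K) :
  (forall i, multilinear (z i)) -> indep_mod z -> (#|I| <= nilp_codim K p n)%N.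
Proof.
move=> Mz zfree; apply: (lfree_lmdim (b := fun i => proj (in_freealgn (z (enum_val i)))) proj_words).
  by move=> i; exists (in_freealgn (z (enum_val i))) => //; apply: multilin_in.
move=> c; rewrite proj_sum proj_eq0 linear_sum.
under eq_bigr => i _ do rewrite linearZ /= multilinear_in //.
move=> H i; rewrite -[i]enum_valK; apply: (zfree (c \o enum_rank)) (enum_val i).
rewrite (reindex (@enum_val I I)) /=; last exact: onW_bij (@enum_val_bij I).
by under eq_bigr => j _ do rewrite enum_valK.
Qed.

(** Lifting a basis of the quotient allows codimensions for different [p] to be compared inside the
    free algebra. *)
Lemma codim_indep : exists z : 'I_(nilp_codim K p n) -> freealg K,
  (forall i, multilinear (z i)) /\ indep_mod z.
Proof.
have [d Hd] := has_dim_span proj_words.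
rewrite /nilp_codim (lmdimE Hd); case: Hd => b [bW bfree _].
have /choice [a Ha] i : exists a, multilin K n a /\ proj a = b i.
  by have [a Ma <-] := bW i; exists a.
exists (fun i => val (a i)); split=> [i|c Hc]; first by case: (Ha i).
apply: bfree; under eq_bigr => i _ do rewrite -(proj2 (Ha i)).
rewrite proj_sum; apply/proj_eq0; rewrite linear_sum.
by under eq_bigr => i _ do rewrite linearZ.
Qed.

Lemma nilp_codim_fact :
  (forall z, multilinear z -> comm_ideal p.+1 z -> z = 0) ->
  nilp_codim K p n = n`!.
Proof.
move=> triv; apply/eqP; rewrite eqn_leq; apply/andP; split.
  have [z [Mz zfree]] := codim_indep.
  apply: (lfree_le (b := fun i => in_freealgn (z i))
    (g := fun i => in_freealgn (word K (word_of i)))) => [c|i].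
    move=> /(congr1 val); rewrite linear_sum linear0 => E; apply: zfree.
    move: E; under eq_bigr => i _ do rewrite linearZ /= multilinear_in //.
    by move=> ->; apply: ideal_gen0.
  by eexists; apply: multilin_expand; apply: multilin_in.
have := @indep_codim 'I_n`! (fun i => word K (word_of i)).
rewrite card_ord; apply=> [i|c].
  by apply: multilinear_word; apply: word_of_perm.
move=> /triv E; apply: words_free; apply: E => m.
rewrite -mcoeff_neq0 coef_sum_words => nz; apply: contraNT nz => nPm.
rewrite big1 // => i _; case: eqP => [E|]; last by rewrite mulr0.
by rewrite -E word_of_perm in nPm.
Qed.

End Codimension.

(** * Comparison of consecutive codimensions *)

Section CodimensionGrowth.
Variable K : fieldType.

(** An ideal containing z also contains [z, v] = zv - vz. *)
Lemma comm_ideal_succ (A : nzRingType) m (a : A) :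
  comm_ideal m.+2 a -> comm_ideal m.+1 a.
Proof.
elim=> {a} [a [u [vs [[sz] ->]]]||a b _ Ia _ Ib|a b _ Ib|a b _ Ia].
- case/lastP: vs sz => // vs v; rewrite size_rcons => -[sz].
  rewrite /lcomm -cats1 foldl_cat /= /rcommutator -mulNr.
  have G : comm_ideal m.+1 (lcomm u vs).
    by apply: ideal_gen_in; exists u, vs; rewrite sz.
  by apply: ideal_genD; [apply: ideal_genMr | apply: ideal_genMl].
- exact: ideal_gen0.
- exact: ideal_genD.
- exact: ideal_genMl.
- exact: ideal_genMr.
Qed.

Lemma nilp_codim_le n p : (nilp_codim K p n <= nilp_codim K p.+1 n)%N.
Proof.
have [z [Mz zfree]] := @codim_indep K n p.
rewrite -[leqLHS]card_ord; apply: (indep_codim Mz) => c Hc.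
by apply: zfree; apply: comm_ideal_succ.
Qed.

(** Adjoin [y] to a lifted basis. In a relation modulo the smaller ideal, reduction modulo the
    larger one kills [y], hence all other coefficients; then the coefficient of [y] vanishes too. *)
Lemma nilp_codim_lt n p (y : freealg K) : multilinear n y ->
  comm_ideal p.+1 y -> ~ comm_ideal p.+2 y ->
  (nilp_codim K p n < nilp_codim K p.+1 n)%N.
Proof.
move=> My Iy nIy; have [z [Mz zfree]] := @codim_indep K n p.
have := @indep_codim K n p.+1 'I_(nilp_codim K p n).+1
  (fun i => if unlift ord0 i is Some j then z j else y).
rewrite card_ord; apply=> [i|c]; first by case: (unlift _ _).
rewrite big_ord_recl unlift_none; under eq_bigr => j _ do rewrite liftK.
move=> Hc; set S := \sum_i _ in Hc.
have cz i : c (lift ord0 i) = 0.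
  apply: (zfree (fun i => c (lift ord0 i))).
  (* The scalar multiple of [y] is written as a ring product because [ideal_gen] is closed under
     products. *)
  have -> : \sum_i c (lift ord0 i) *: z i = (c ord0 *: y + S) + (- c ord0)%:A * y.
    by rewrite -scalerAl mul1r scaleNr addrAC subrr add0r.
  by apply: ideal_genD; [apply: comm_ideal_succ | apply: ideal_genMl].
have S0 : S = 0 by rewrite /S big1 // => i _; rewrite cz scale0r.
move=> i; case: (unliftP ord0 i) => [j ->|->]; first exact: cz.
apply: contrapT => /eqP nz; apply: nIy; move: Hc; rewrite S0 addr0 => Hc.
have -> : y = (c ord0)^-1%:A * (c ord0 *: y).
  by rewrite -scalerAl mul1r scalerA mulVf // scale1r.
exact: ideal_genMl.
Qed.

End CodimensionGrowth.

(** * Degrees of the elements of the commutator ideals *)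

Section Homogeneity.
Variable K : fieldType.
Implicit Types (z : freealg K) (w : seq nat).

Definition has_letters w z :=
  forall m : {fmonom nat}, m \in msupp z -> perm_eq m w.

Lemma has_letters_word w : has_letters w (word K w).
Proof. by move=> m; rewrite msuppU1 inE => /eqP ->. Qed.

Lemma has_lettersM w w' z z' :
  has_letters w z -> has_letters w' z' -> has_letters (w ++ w') (z * z').
Proof.
move=> Hz Hz' m /msuppM_le [m1 [m2 [m1z m2z ->]]].
by rewrite fmM perm_cat // ?Hz ?Hz'.
Qed.

Lemma has_lettersB w z z' :
  has_letters w z -> has_letters w z' -> has_letters w (z - z').
Proof.
move=> Hz Hz' m /(fsubsetP (msuppB_le _ _)); rewrite inE => /orP [].
  exact: Hz.
exact: Hz'.
Qed.

Lemma has_letters_perm w w' z :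
  perm_eq w w' -> has_letters w z -> has_letters w' z.
Proof. by move=> E Hz m /Hz P; apply: perm_trans E. Qed.

Lemma has_letters_comm w : has_letters w (letter_comm (@word K) w).
Proof.
case: w => [|x w] /=; first by rewrite -word_nil; apply: has_letters_word.
elim/last_ind: w => [|w y IH]; first exact: has_letters_word.
rewrite map_rcons lcomm_rcons /rcommutator -rcons_cons -cats1.
apply: has_lettersB; first by apply: has_lettersM => //; apply: has_letters_word.
apply: has_letters_perm (has_lettersM (has_letters_word (w := [:: y])) IH).
by rewrite perm_catC.
Qed.

Lemma has_letters_comm_product w vs :
  has_letters (w ++ flatten vs) (comm_product (@word K) w vs).
Proof.
apply: has_lettersM; first exact: has_letters_word.
elim: vs => [|v vs IH]; first by rewrite big_nil -word_nil; apply: has_letters_word.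
by rewrite big_cons; apply: has_lettersM => //; apply: has_letters_comm.
Qed.

End Homogeneity.

Section LinearFunctionalMul.
Variables (K : fieldType) (A : algType K) (gen : seq nat -> A).
Hypothesis gen_cat : forall u v, gen (u ++ v) = gen u * gen v.
Hypothesis span_ind : forall P : A -> Prop,
  P 0 -> (forall a b, P a -> P b -> P (a + b)) ->
  (forall c w, P (c *: gen w)) -> forall a, P a.
Variables phi psi : A -> K.
Hypotheses (phi0 : phi 0 = 0) (psi0 : psi 0 = 0).
Hypothesis phiD : forall a b, phi (a + b) = phi a + phi b.
Hypothesis psiD : forall a b, psi (a + b) = psi a + psi b.
Hypothesis phiZ : forall c a, phi (c *: a) = c * phi a.
Hypothesis psiZ : forall c a, psi (c *: a) = c * psi a.

Lemma linear_fun_mulr w z :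
  (forall v, phi (gen (v ++ w)) = psi (gen v)) -> phi (z * gen w) = psi z.
Proof.
move=> E; elim/span_ind: z => [|a b Ha Hb|c v]; first by rewrite mul0r phi0.
  by rewrite mulrDl phiD psiD Ha Hb.
by rewrite -scalerAl -gen_cat phiZ psiZ E.
Qed.

Lemma linear_fun_mull w z :
  (forall v, phi (gen (w ++ v)) = psi (gen v)) -> phi (gen w * z) = psi z.
Proof.
move=> E; elim/span_ind: z => [|a b Ha Hb|c v]; first by rewrite mulr0 phi0.
  by rewrite mulrDr phiD psiD Ha Hb.
by rewrite -scalerAr -gen_cat phiZ psiZ E.
Qed.

End LinearFunctionalMul.

Lemma eqseq_catr (T : eqType) (u v w : seq T) : (u ++ w == v ++ w) = (u == v).
Proof.
apply/eqP/eqP => [E|->//]; have := E => /eqP; rewrite eqseq_cat => [/andP [/eqP]//|].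
by move/(congr1 size): E; rewrite !size_cat => /addIn.
Qed.

Section RestrictedDegree.
Variables (K : fieldType) (q : pred nat).
Implicit Types (z : freealg K) (u v w t : seq nat).

Lemma lin_ext_mulr (phi : seq nat -> K) z w :
  lin_ext phi (z * word K w) = lin_ext (fun v => phi (v ++ w)) z.
Proof.
apply: (linear_fun_mulr (@word_cat K) (@word_ind K)) => *; rewrite ?lin_ext0 ?lin_ext_word //.
all: by rewrite ?lin_extD ?lin_extZ.
Qed.

Lemma lin_ext_mull (phi : seq nat -> K) z w :
  lin_ext phi (word K w * z) = lin_ext (fun v => phi (w ++ v)) z.
Proof.
apply: (linear_fun_mull (@word_cat K) (@word_ind K)) => *; rewrite ?lin_ext0 ?lin_ext_word //.
all: by rewrite ?lin_extD ?lin_extZ.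
Qed.

Lemma lin_ext_fun0 z : lin_ext (fun=> 0) z = 0.
Proof. by rewrite /lin_ext /mmap big1 // => m _; rewrite mulr0. Qed.

(** Extended linearly, this is the coefficient of [t] after the substitution of 1 for the letters
    outside [q]. *)
Definition restr_coef t : seq nat -> K := fun w => (filter q w == t)%:R.

(* After setting the letters outside q to 1, no monomial is shorter than l. *)
Definition valuation_ge l z := forall t, (size t < l)%N -> lin_ext (restr_coef t) z = 0.

Lemma valuation_mulr l z w : valuation_ge l z ->
  valuation_ge (l + size (filter q w)) (z * word K w).
Proof.
move=> Hz t szt; rewrite lin_ext_mulr.
(* What remains of [t] after its suffix [filter q w] is removed; if there is no such suffix, the
   coefficient is 0. *)
pose t' := take (size t - size (filter q w)) t.
have [Et|Et] := eqVneq t (t' ++ filter q w).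
  rewrite (lin_ext_ext (psi := restr_coef t')) => [|v].
    by apply: Hz; move: szt; rewrite (congr1 size Et) size_cat ltn_add2r.
  by rewrite /restr_coef filter_cat {1}Et eqseq_catr.
rewrite (lin_ext_ext (psi := fun=> 0)) ?lin_ext_fun0 // => v.
rewrite /restr_coef filter_cat; case: eqP => // E; case/negP: Et; apply/eqP.
by rewrite /t' -E size_cat addnK take_size_cat.
Qed.

Lemma valuation_mull l z w : valuation_ge l z ->
  valuation_ge (size (filter q w) + l) (word K w * z).
Proof.
move=> Hz t szt; rewrite lin_ext_mull.
pose t' := drop (size (filter q w)) t.
have [Et|Et] := eqVneq t (filter q w ++ t').
  rewrite (lin_ext_ext (psi := restr_coef t')) => [|v].
    by apply: Hz; move: szt; rewrite (congr1 size Et) size_cat ltn_add2l.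
  by rewrite /restr_coef filter_cat {1}Et eqseq_cat // eqxx.
rewrite (lin_ext_ext (psi := fun=> 0)) ?lin_ext_fun0 // => v.
rewrite /restr_coef filter_cat; case: eqP => // E; case/negP: Et; apply/eqP.
by rewrite /t' -E drop_size_cat.
Qed.

(** If [w] has no letter in [q], it becomes 1 and the commutator dies; otherwise both products gain
    at least one degree. *)
Lemma valuation_comm l z w : valuation_ge l z ->
  valuation_ge l.+1 (rcommutator z (word K w)).
Proof.
move=> Hz t szt; rewrite /rcommutator lin_extD lin_extN.
suff [E|[E1 E2]] :
    lin_ext (restr_coef t) (z * word K w) = lin_ext (restr_coef t) (word K w * z) \/
    lin_ext (restr_coef t) (z * word K w) = 0 /\ lin_ext (restr_coef t) (word K w * z) = 0.
- by apply/eqP; rewrite subr_eq0; apply/eqP.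
- by rewrite [X in X - _]E1 [X in _ - X]E2 subr0.
have [w0|wn] := posnP (size (filter q w)); [left | right].
  apply: etrans (lin_ext_mulr _ z w) _; apply: etrans (esym (lin_ext_mull _ z w)).
  by apply: lin_ext_ext => v; rewrite /restr_coef !filter_cat (size0nil w0) cats0.
by split; [apply: (valuation_mulr Hz) | apply: (valuation_mull Hz)]; lia.
Qed.

Lemma valuation_word w : valuation_ge (size (filter q w)) (word K w).
Proof.
by move=> t szt; rewrite lin_ext_word /restr_coef; case: eqP => // E; rewrite E ltnn in szt.
Qed.

(** The first bracket accounts for degree two: it dies when [u] becomes 1, and otherwise starts from
    degree at least one. *)
Lemma valuation_lcomm u v vs :
  valuation_ge (size vs).+2 (lcomm (word K u) (map (@word K) (v :: vs))).
Proof.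
elim/last_ind: vs => [|vs w IH]; last first.
  by rewrite size_rcons -rcons_cons map_rcons lcomm_rcons; apply: valuation_comm.
rewrite /lcomm /=.
have [u0|un] := posnP (size (filter q u)).
  move=> t _; rewrite /rcommutator lin_extD lin_extN -!word_cat.
  by rewrite !lin_ext_word /restr_coef !filter_cat (size0nil u0) cats0 subrr.
have := valuation_comm v (@valuation_word u).
by move=> H t szt; apply: H; lia.
Qed.

Lemma comm_ideal_valuation m z : comm_ideal m.+2 z -> valuation_ge m.+2 z.
Proof.
move=> Iz t szt; move: Iz; apply: (comm_ideal_vanish (@word_ind K)).
- exact: lin_ext0.
- exact: lin_extD.
- exact: lin_extZ.
move=> u [|v vs] // [szvs] x w.
have := @valuation_lcomm u v vs; rewrite szvs => Hy.
by apply: (valuation_mulr (valuation_mull Hy)); lia.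
Qed.

End RestrictedDegree.

Section LowDegree.
Variable K : fieldType.

(** With every letter kept, the restricted coefficients are the ordinary ones, and words of length
    [n] are too short for the ideal. *)
Lemma multilinear_comm_ideal0 n p (z : freealg K) :
  (n <= p.+1)%N -> multilinear n z -> comm_ideal p.+2 z -> z = 0.
Proof.
move=> np Mz Iz; apply/malgP => m; rewrite mcoeff0.
case: (msuppP z m) => // mz.
have := @comm_ideal_valuation K predT _ _ Iz m.
rewrite (perm_size (Mz _ mz)) size_iota => /(_ np) <-.
rewrite (lin_ext_ext (psi := fun v => (v == m)%:R)) ?lin_ext_coef ?fmK // => v.
by rewrite /restr_coef filter_predT.
Qed.

Lemma nilp_codim_low n p : (n <= p.+1)%N -> nilp_codim K p.+1 n = n`!.
Proof. by move=> np; apply: nilp_codim_fact => z; apply: multilinear_comm_ideal0. Qed.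

(** In each bracket [z, y] only zy contributes, because the words of yz begin with y, which differs
    from [x]. *)
Lemma letter_comm_coef (q : pred nat) x w : uniq (x :: w) -> all q (x :: w) ->
  lin_ext (restr_coef K q (x :: w)) (letter_comm (@word K) (x :: w)) = 1.
Proof.
elim/last_ind: w => [|w y IH].
  by rewrite /= lin_ext_word /restr_coef /= => _ /andP [-> _]; rewrite eqxx.
rewrite -rcons_cons rcons_uniq all_rcons => /andP [yw Uw] /andP [qy qw].
rewrite /= map_rcons lcomm_rcons /rcommutator lin_extD lin_extN.
set z := lcomm _ _; rewrite (lin_ext_mulr _ z [:: y]) (lin_ext_mull _ z [:: y]) {}/z.
rewrite (lin_ext_ext (psi := restr_coef K q (x :: w))) => [|v].
  rewrite [lin_ext _ _]IH // (lin_ext_ext (psi := fun=> 0)) ?lin_ext_fun0 ?subr0 // => v.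
  rewrite /restr_coef /= qy eqseq_cons; case: eqP => // E.
  by rewrite E inE eqxx in yw.
by rewrite /restr_coef filter_cat /= qy cats1 -rcons_cons eqseq_rcons eqxx andbT.
Qed.

(** The witness is a commutator of the first p + 1 letters times the other letters. Setting those
    others to 1 leaves a monomial of length p + 1, too short for the next ideal. *)
Lemma nilp_codim_step n p : (p < n)%N ->
  (nilp_codim K p n < nilp_codim K p.+1 n)%N.
Proof.
move=> pn; pose y := letter_comm (@word K) (iota 0 p.+1) * word K (iota p.+1 (n - p.+1)).
apply: (nilp_codim_lt (y := y)).
- move=> m my; rewrite -(subnKC pn) iotaD add0n.
  have H := has_lettersM (@has_letters_comm K (iota 0 p.+1))
    (@has_letters_word K (iota p.+1 (n - p.+1))).
  exact: H my.
- apply: ideal_genMr; apply: ideal_gen_in; rewrite /=.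
  by do 2!eexists; split; last reflexivity; rewrite !size_map size_iota.
move=> /(@comm_ideal_valuation K (fun i => (i < p.+1)%N)) /(_ (iota 0 p.+1)).
rewrite size_iota ltnSn => /(_ isT); rewrite /y lin_ext_mulr.
rewrite (lin_ext_ext (psi := restr_coef K (fun i => (i < p.+1)%N) (iota 0 p.+1))) => [|v].
  rewrite letter_comm_coef; last 2 first.
  - exact: (iota_uniq 0 p.+1).
  - by apply/allP => i; rewrite -[0%N :: _]/(iota 0 p.+1) mem_iota.
  by move/eqP; rewrite oner_eq0.
rewrite /restr_coef filter_cat [X in _ ++ X](_ : _ = [::]) ?cats0 //.
rewrite (eq_in_filter (a2 := pred0)) ?filter_pred0 // => i.
by rewrite mem_iota => /andP [pi _]; rewrite ltnNge pi.
Qed.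

End LowDegree.

(** * The independent family *)

(** Apply the functional of [i] to a relation. Products with fewer commutator letters have
    coefficient 0 by induction, the others evaluate to 0 except that of [i] itself, whose value is a
    sign times a power of 2. *)
Lemma codim_family (K : fieldType) (charK : [pchar K] =i pred0) (n r : nat) (I : finType)
    (A : I -> pred nat) (M : I -> seq (nat * nat)) (pre : I -> seq nat)
    (vs : I -> seq (seq nat)) :
  (forall i, size (M i) = r) ->
  (forall i, perm_eq (pre i ++ flatten (vs i)) (iota 0 n)) ->
  (forall i, all (good_block (A i) (M i)) (vs i)) ->
  (forall i j, all (good_block (A i) (M i)) (vs j) ->
     (size (flatten (vs i)) <= size (flatten (vs j)))%N -> i = j) ->
  (#|I| <= nilp_codim K (2 * r + 2) n)%N.
Proof.
move=> szM Pvs good sep; pose z i := comm_product (@word K) (pre i) (vs i).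
apply: (indep_codim (z := z)) => [i m mz|c Ic i].
  exact: perm_trans (has_letters_comm_product mz) (Pvs i).
have [s] := ubnP (size (flatten (vs i))); elim: s i => // s IH i lt_s.
have := @sign_ext_comm_ideal K (A i) (M i) n (2 * r + 2).
rewrite szM ltn_add2l => /(_ isT _ Ic).
rewrite /sign_ext lin_ext_sum (bigD1 i) //= big1 ?addr0 => [|j ji].
  have [e] := @sign_ext_comm_product K (A i) (M i) n (pre i) (vs i).
  rewrite good mul1r /sign_fun Pvs lin_extZ /sign_ext => ->.
  move/eqP; rewrite !mulf_eq0 signr_eq0 orbF => /orP [/eqP //|].
  by have /pcharf0P ch := charK; rewrite expf_eq0 ch andbF.
rewrite lin_extZ; have [e] := @sign_ext_comm_product K (A i) (M i) n (pre j) (vs j).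
rewrite /sign_ext => ->; case: (boolP (all _ _)) => [gij|_]; last by rewrite !mul0r mulr0.
rewrite ltnS in lt_s; rewrite IH ?mul0r //; apply: leq_trans lt_s; rewrite ltnNge.
by apply: contra_neqN ji => /(sep _ _ gij).
Qed.

Local Open Scope nat_scope.

(** * Nonvanishing conditions for short commutators *)

Section GoodBlocks.
Variables (A : pred nat) (M : seq (nat * nat)).
Local Notation om := (omega A M).

Definition touched x := has (fun p => (p.1 == x) || (p.2 == x)) M.

Lemma adj_touched x y : adj M x y -> touched x.
Proof. by case/orP => H; apply/hasP; [exists (x, y)|exists (y, x)]; rewrite //= eqxx ?orbT. Qed.

Lemma omega_support x y : om x y -> A x || touched x.
Proof.
rewrite /omega; case: (boolP (adj M x y)) => [/adj_touched ->|_]; first by rewrite orbT.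
by rewrite addbF => /andP [->].
Qed.

Lemma cross_has (T : eqType) (f : T -> T -> bool) u y :
  cross f u [:: y] -> has (f^~ y) u.
Proof.
apply: contraLR => /hasPn H; rewrite /cross big_seq big1 // => x /H nf.
by rewrite big_seq1 (negPf nf).
Qed.

(** A letter that is neither in [A] nor on an edge commutes with everything, so it cannot occur in a
    commutator with nonzero value. *)
Lemma good_block_support w : 1 < size w -> good_block A M w ->
  {in w, forall x, A x || touched x}.
Proof.
case: w => [|x [|y w]] //= _ /andP [Hxy Hw] z; rewrite inE => /orP [/eqP ->|].
  by move: Hxy; rewrite /cross !big_seq1; apply: omega_support.
rewrite inE => /orP [/eqP ->|].
  by move: Hxy; rewrite /cross !big_seq1 omegaC; apply: omega_support.
elim: w [:: x; y] Hw => //= t w IH u /andP [Hut Hw].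
rewrite inE => /orP [/eqP ->|]; last exact: (IH _ Hw).
by have /hasP [v _] := cross_has Hut; rewrite omegaC; apply: omega_support.
Qed.

Lemma good_block2 x y : good_block A M [:: x; y] = om x y.
Proof. by rewrite /= /cross !big_seq1 andbT. Qed.

Lemma good_block3 s x y :
  good_block A M [:: s; x; y] = om s x && (om s y (+) om x y).
Proof. by rewrite /= /cross !(big_cons, big_nil) !addbF andbT. Qed.

Lemma good_block4 s x y t : good_block A M [:: s; x; y; t] =
  [&& om s x, om s y (+) om x y & om s t (+) (om x t (+) om y t)].
Proof. by rewrite /= /cross !(big_cons, big_nil) !addbF andbT. Qed.

End GoodBlocks.

Section Enumerations.
Variable T : finType.
Implicit Types (S : {set T}) (p : pred T).

Lemma count_enumU p S S' : [disjoint S & S'] ->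
  count p (enum (S :|: S')) = count p (enum S) + count p (enum S').
Proof.
move=> dis; rewrite -count_cat; apply/permP: p; apply: uniq_perm.
- exact: enum_uniq.
- rewrite cat_uniq !enum_uniq andbT /=; apply/hasPn => x; rewrite !mem_enum => xS'.
  by rewrite (disjointFl dis).
- by move=> x; rewrite mem_cat !mem_enum inE.
Qed.

Lemma count_enum_seq p (s : seq T) : uniq s ->
  count p (enum [set x in s]) = count p s.
Proof.
move=> Us; apply/permP: p; apply: uniq_perm => //; first exact: enum_uniq.
by move=> x; rewrite mem_enum inE.
Qed.

(** An unpaired last letter is dropped; for valid data the paired sequence has even length. *)
Fixpoint pair_up (s : seq T) :=
  if s is x :: y :: s' then [:: x; y] :: pair_up s' else [::].

Lemma flatten_pair_up s : ~~ odd (size s) -> flatten (pair_up s) = s.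
Proof.
have [m] := ubnP (size s); elim: m s => // m IH [|x [|y s]] //= lt_s ev.
by rewrite IH //; [lia | rewrite negbK in ev].
Qed.

Lemma mem_pair_up s w : w \in pair_up s -> exists x y, [/\ w = [:: x; y], x \in s & y \in s].
Proof.
have [m] := ubnP (size s); elim: m s => // m IH [|x [|y s]] //= lt_s.
rewrite inE => /orP [/eqP ->|/IH [|x' [y' [-> x's y's]]]]; last 2 first.
- by lia.
- by exists x', y'; rewrite !inE x's y's !orbT.
by exists x, y; rewrite !inE !eqxx orbT.
Qed.

Lemma count_triples p (ss : seq T) (L : seq (T * T)) : size ss = size L ->
  count p (flatten [seq [:: q.1; q.2.1; q.2.2] | q <- zip ss L]) =
  count p ss + (count p (unzip1 L) + count p (unzip2 L)).
Proof.
elim: ss L => [|s ss IH] [|[x y] L] //= [sz].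
by rewrite IH //; lia.
Qed.

Lemma mem_zip_right (S1 S2 : eqType) (s : seq S1) (t : seq S2) y :
  size s = size t -> y \in t -> exists2 x, x \in s & (x, y) \in zip s t.
Proof.
elim: s t => [|a s IH] [|b t] //= [sz]; rewrite inE => /orP [/eqP ->|yt].
  by exists a; rewrite inE eqxx.
by have [x xs xy] := IH _ sz yt; exists x; rewrite inE ?xs ?xy orbT.
Qed.

End Enumerations.

Section Encoding.
Variable n : nat.
Implicit Types (S : {set 'I_n}) (L : seq ('I_n * 'I_n)).

Definition codes S : pred nat := fun x => x \in map val (enum S).

Lemma codesE S (x : 'I_n) : codes S (val x) = (x \in S).
Proof. by rewrite /codes mem_map ?mem_enum //; apply: val_inj. Qed.

Definition nat_edges L : seq (nat * nat) := [seq (val q.1, val q.2) | q <- L].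

Lemma mem_nat_edges L (x y : 'I_n) : ((val x, val y) \in nat_edges L) = ((x, y) \in L).
Proof.
rewrite /nat_edges (mem_map (f := fun q : 'I_n * 'I_n => (val q.1, val q.2)) _ L (x, y)) //.
by move=> [a b] [a' b'] [/val_inj -> /val_inj ->].
Qed.

Lemma adj_nat_edges L (x y : 'I_n) :
  adj (nat_edges L) (val x) (val y) = ((x, y) \in L) || ((y, x) \in L).
Proof. by rewrite /adj !mem_nat_edges. Qed.

End Encoding.

(* A datum (e, E, I, J, V) stands for the functional with odd letters V, E, I whose
   edges are I_l -> J_l (tail odd, head not) and, when e = 1, the pair E (both ends
   odd).  All edges avoid the first d letters, the set low, from which V provides
   the filler letters ("specials") of the long blocks of the test polynomial. *)
Section TestData.
Variables (n d r : nat).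
Local Notation T := 'I_n.
Implicit Types (e : bool) (E I V : {set T}) (J : seq T).

Definition low : {set T} := [set i : T | i < d].

Definition edges E I J : seq (T * T) :=
  zip (enum I) J ++ (if enum E is [:: a; b] then [:: (a, b)] else [::]).

Definition used_letters E I J V : {set T} := V :|: (E :|: (I :|: [set x in J])).

(** One filler for each of the r - e triples and two for the block of four: (r - e) + 2e = r + e. *)
Definition specials e V : seq T := take (r + e) (enum (V :&: low)).

(* The size of [:: s; a; b; t] differs by one in parity from that of [:: s; i; j], so
   the two values of e cover the two parities of the number of letters. *)
Definition blocks e E I J V : seq (seq T) :=
  [seq [:: q.1; q.2.1; q.2.2] |
     q <- zip (take (r - e) (specials e V)) (zip (enum I) J)] ++
  (if (enum E, drop (r - e) (specials e V)) is ([:: a; b], [:: s; t])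
   then [:: [:: s; a; b; t]] else [::]) ++
  pair_up (enum (V :\: [set x in specials e V])).

(** The parity of [V] lets its letters outside [specials] be paired off, and more than [r] low
    letters guarantee the r + e fillers. As [I] is enumerated in a fixed order, the order of [J]
    encodes the matching. *)
Definition valid e E I J V : bool :=
  [&& [&& E \subset ~: low & #|E| == (2 * e)%N],
      [&& I \subset ~: low :\: E & #|I| == (r - e)%N],
      [&& all [in ~: low :\: E :\: I] J, uniq J & size J == (r - e)%N]
    & [&& V \subset ~: (E :|: (I :|: [set x in J])), odd #|V| == odd (r + e)
        & r < #|V :&: low|]].

Section Facts.
Variables (e : bool) (E I : {set T}) (J : seq T) (V : {set T}).
Hypotheses (r_gt0 : 0 < r) (Hv : valid e E I J V).

Lemma valid_cardE : #|E| = (2 * e)%N.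
Proof. by case/and4P: Hv => /andP [_ /eqP]. Qed.

Lemma valid_cardI : #|I| = (r - e)%N.
Proof. by case/and4P: Hv => _ /andP [_ /eqP]. Qed.

Lemma valid_uniqJ : uniq J.
Proof. by case/and4P: Hv => _ _ /and3P []. Qed.

Lemma valid_sizeJ : size J = (r - e)%N.
Proof. by case/and4P: Hv => _ _ /and3P [_ _ /eqP]. Qed.

Lemma valid_E x : x \in E -> [/\ x \notin low, x \notin I, x \notin J & x \notin V].
Proof.
case/and4P: Hv => /andP [/fintype.subsetP sE _] /andP [/fintype.subsetP sI _] /and3P [/allP sJ _ _].
move=> /and3P [/fintype.subsetP sV _ _] xE; split.
- by have := sE _ xE; rewrite inE.
- by apply/negP => /sI; rewrite inE xE.
- by apply/negP => /sJ; rewrite !inE xE andbF.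
- by apply/negP => /sV; rewrite !inE xE.
Qed.

Lemma valid_I x : x \in I -> [/\ x \notin low, x \notin E, x \notin J & x \notin V].
Proof.
case/and4P: Hv => /andP [/fintype.subsetP sE _] /andP [/fintype.subsetP sI _] /and3P [/allP sJ _ _].
move=> /and3P [/fintype.subsetP sV _ _] xI; split.
- by have := sI _ xI; rewrite !inE => /andP [].
- by have := sI _ xI; rewrite !inE => /andP [].
- by apply/negP => /sJ; rewrite !inE xI.
- by apply/negP => /sV; rewrite !inE xI orbT.
Qed.

Lemma valid_J x : x \in J -> [/\ x \notin low, x \notin E, x \notin I & x \notin V].
Proof.
case/and4P: Hv => /andP [/fintype.subsetP sE _] /andP [/fintype.subsetP sI _] /and3P [/allP sJ _ _].
move=> /and3P [/fintype.subsetP sV _ _] xJ; have := sJ _ xJ; rewrite !inE => /and3P [nI nE nl].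
by split=> //; apply/negP => /sV; rewrite !inE xJ !orbT.
Qed.

Lemma valid_oddV : odd #|V| = odd (r + e).
Proof. by case/and4P: Hv => _ _ _ /and3P [_ /eqP]. Qed.

Lemma valid_lowV : r < #|V :&: low|.
Proof. by case/and4P: Hv => _ _ _ /and3P []. Qed.

Lemma size_specials : size (specials e V) = r + e.
Proof.
rewrite size_takel // -cardE; apply: leq_trans valid_lowV.
by case: (e); rewrite ?addn0 ?addn1.
Qed.

Lemma specials_uniq : uniq (specials e V).
Proof. by apply: take_uniq; apply: enum_uniq. Qed.

Lemma mem_specials x : x \in specials e V -> x \in V /\ x \in low.
Proof. by move/mem_take; rewrite mem_enum inE => /andP. Qed.

Lemma size_enumI : size (enum I) = size J.
Proof. by rewrite -cardE valid_cardI valid_sizeJ. Qed.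

Lemma size_special_zip : size (take (r - e) (specials e V)) = size (zip (enum I) J).
Proof.
rewrite size1_zip ?size_enumI // valid_sizeJ size_takel // size_specials; lia.
Qed.

Lemma size_edges : size (edges E I J) = r.
Proof.
rewrite size_cat size1_zip ?size_enumI // valid_sizeJ.
have := valid_cardE; rewrite cardE; case: (enum E) => [|a [|b [|]]] //=; case: (e) => //=; lia.
Qed.

Lemma count_support p : count p (enum (used_letters E I J V)) =
  count p (enum V) + (count p (enum E) + (count p (enum I) + count p J)).
Proof.
rewrite /used_letters !count_enumU ?count_enum_seq //; first exact: valid_uniqJ.
- by rewrite finset.disjoints_subset; apply/fintype.subsetP => x /valid_I [_ _ ? _]; rewrite !inE.
- rewrite finset.disjoints_subset; apply/fintype.subsetP => x /valid_E [_ H1 H2 _].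
  by rewrite !inE (negPf H1) (negPf H2).
- rewrite finset.disjoints_subset; apply/fintype.subsetP => x xV; rewrite !inE; apply/negP.
  case/or3P; first by move/valid_E=> [_ _ _]; rewrite xV.
  - by move/valid_I=> [_ _ _]; rewrite xV.
  - by move/valid_J=> [_ _ _]; rewrite xV.
Qed.

Lemma enumE_drop :
  (exists2 ab, enum E = [:: ab.1; ab.2] &
     exists st, drop (r - e) (specials e V) = [:: st.1; st.2]) \/
  (enum E = [::] /\ drop (r - e) (specials e V) = [::]).
Proof.
have := valid_cardE; rewrite cardE.
have : size (drop (r - e) (specials e V)) = (2 * e)%N.
  by rewrite size_drop size_specials; case: (e) => /=; lia.
case: (e) => /=.
  case: (drop _ _) => [|s [|t [|]]] //= _; case: (enum E) => [|a [|b [|]]] //= _.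
  by left; exists (a, b) => //; exists (s, t).
by case: (drop _ _) => //= _; case: (enum E) => //= _; right.
Qed.

Lemma count_blocks p :
  count p (flatten (blocks e E I J V)) = count p (enum (used_letters E I J V)).
Proof.
rewrite count_support /blocks !flatten_cat !count_cat count_triples ?size_special_zip //.
rewrite unzip1_zip ?unzip2_zip ?size_enumI //.
have Ev : count p (enum V) =
    count p (specials e V) + count p (enum (V :\: [set x in specials e V])).
  rewrite -(count_enum_seq _ specials_uniq) -count_enumU.
    congr (count p (enum (pred_of_set _))); apply/setP => x; rewrite !inE.
    by case: (boolP (x \in specials e V)) => [/mem_specials [-> _]|].
  by rewrite finset.disjoints_subset; apply/fintype.subsetP => x; rewrite !inE => ->.
(* The remainder of [V] is even, since [V] and the r + e specials have the same parity. *)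
rewrite flatten_pair_up; last first.
  have Ec : size (enum V) = size (specials e V) + size (enum (V :\: [set x in specials e V])).
    rewrite -!cardE -(finset.cardsID [set x in specials e V] V); congr (_ + _).
    have <- : #|[set x in specials e V]| = size (specials e V).
      by rewrite cardsE; apply/card_uniqP/specials_uniq.
    apply: eq_card => x; rewrite !inE.
    by case: (boolP (x \in specials e V)) => [/mem_specials [-> _]|]; rewrite ?andbF.
  have := valid_oddV; rewrite cardE Ec size_specials oddD.
  by case: (odd (r + e)) => /=; case: (odd (size _)).
have Es : count p (specials e V) =
    count p (take (r - e) (specials e V)) + count p (drop (r - e) (specials e V)).
  by rewrite -count_cat cat_take_drop.
rewrite Ev Es.
by case: enumE_drop => [[[a b] /= -> [[s t] /= ->]]|[-> ->]] /=; lia.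
Qed.

Definition prefix_letters : seq T := enum (~: used_letters E I J V).

Lemma perm_blocks :
  perm_eq (map val prefix_letters ++ flatten (map (map val) (blocks e E I J V)))
    (iota 0 n).
Proof.
rewrite -map_flatten -map_cat -val_enum_ord; apply: perm_map; apply/permP => p.
rewrite count_cat count_blocks -count_enumU; last first.
  by rewrite disjoint_sym finset.disjoints_subset finset.setCK.
by rewrite finset.setUC finset.setUCr enumT enum_setT.
Qed.

Lemma size_blocks : size (flatten (map (map val) (blocks e E I J V))) = #|used_letters E I J V|.
Proof.
by rewrite -map_flatten size_map -count_predT count_blocks count_predT -cardE.
Qed.

Lemma mem_blocks x : (x \in flatten (blocks e E I J V)) = (x \in used_letters E I J V).
Proof.
rewrite -[RHS]mem_enum; apply: perm_mem; apply/permP => p; exact: count_blocks.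
Qed.

Lemma edges_cases x y : (x, y) \in edges E I J ->
  (x \in I /\ y \in J /\ (x, y) \in zip (enum I) J) \/ enum E = [:: x; y].
Proof.
rewrite mem_cat => /orP [H|].
  left; split; last split=> //.
    by rewrite -mem_enum -(unzip1_zip (s := enum I) (t := J)) ?size_enumI //; apply: map_f H.
  by rewrite -(unzip2_zip (s := enum I) (t := J)) ?size_enumI //; apply: map_f H.
case: (enum E) => [|a [|b [|]]] //; rewrite inE => /eqP [-> ->]; by right.
Qed.

End Facts.
End TestData.

(** * Evaluation of a datum on blocks *)

Section SignData.
Variables (n d r : nat).
Local Notation T := 'I_n.

Definition odd_letters (E I V : {set T}) : {set T} := V :|: (E :|: I).

Section Own.
Variables (e : bool) (E I : {set T}) (J : seq T) (V : {set T}).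
Hypotheses (r_gt0 : 0 < r) (Hv : valid d r e E I J V).
Local Notation A := (odd_letters E I V).
Local Notation L := (edges E I J).
Local Notation om x y := (omega (codes A) (nat_edges L) (val x) (val y)).
Local Notation good w := (good_block (codes A) (nat_edges L) (map val w)).
Implicit Types (s t a b i j x y : T).

Definition joined x y := ((x, y) \in L) || ((y, x) \in L).

Lemma omE x y : om x y = ((x \in A) && (y \in A)) (+) joined x y.
Proof. by rewrite /omega adj_nat_edges !codesE. Qed.

Lemma edges_mem x y : (x, y) \in L ->
  [/\ x \notin V, y \notin V, x \notin low n d & y \notin low n d] /\
  x \in used_letters E I J V /\ y \in used_letters E I J V.
Proof.
case/(edges_cases Hv) => [[xI [yJ _]]|EE].
  have [? _ _ ?] := valid_I Hv xI; have [? _ _ ?] := valid_J Hv yJ.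
  by split; [split|rewrite !inE xI yJ !orbT].
have xE : x \in E by rewrite -mem_enum EE inE eqxx.
have yE : y \in E by rewrite -mem_enum EE !inE eqxx orbT.
have [? _ _ ?] := valid_E Hv xE; have [? _ _ ?] := valid_E Hv yE.
by split; [split|rewrite !inE xE yE !orbT].
Qed.

Lemma joined_low s x : s \in low n d -> joined s x = false.
Proof.
by move=> sl; apply/negP => /orP [] /edges_mem [[_ _ H1 H2] _]; move: H1 H2; rewrite sl.
Qed.

Lemma joined_V s x : s \in V -> joined s x = false.
Proof.
by move=> sl; apply/negP => /orP [] /edges_mem [[H1 H2 _ _] _]; move: H1 H2; rewrite sl.
Qed.

Lemma joinedC x y : joined x y = joined y x.
Proof. by rewrite /joined orbC. Qed.

(** A low letter lies on no edge, so the first bracket needs [s] and [i] odd. In the second their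
    odd contributions cancel and only an edge between [i] and [j] is left. *)
Lemma good3E s i j : s \in low n d -> good [:: s; i; j] ->
  i \in A /\ joined i j.
Proof.
move=> sl; rewrite good_block3 !omE !(joined_low _ sl) !addbF => /andP [/andP [sA iA]].
by rewrite sA iA /=; case: (j \in A) => //=; case: (joined i j).
Qed.

(** As for triples, but now the last bracket with [t] forces [b] to be odd as well; this tells the
    edge [E] from the edges between [I] and [J]. *)
Lemma good4E s a b t : s \in low n d -> t \in low n d -> good [:: s; a; b; t] ->
  [/\ a \in A, b \in A & joined a b].
Proof.
move=> sl tl; rewrite good_block4 !omE.
rewrite (joined_low _ sl) (joined_low _ sl) (joined_low _ sl).
rewrite (joinedC a t) (joinedC b t) !(joined_low _ tl) !addbF.
case: (s \in A) => //=; case: (a \in A) => //=.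
by case: (b \in A); case: (t \in A); case: (joined a b).
Qed.

Lemma blocks_cases w : w \in blocks d r e E I J V ->
  [\/ exists s i j, [/\ w = [:: s; i; j], s \in V, s \in low n d & (i, j) \in zip (enum I) J],
      exists s a b t, [/\ w = [:: s; a; b; t], s \in V, s \in low n d, t \in V & t \in low n d]
        /\ enum E = [:: a; b] |
      exists x y, [/\ w = [:: x; y], x \in V & y \in V]].
Proof.
rewrite !mem_cat => /or3P [/mapP [[s [i j]] /= H ->]|H|H].
- have /mem_take /mem_specials [sV sl] : s \in take (r - e) (specials d r e V).
    have sz : size (take (r - e) (specials d r e V)) <= size (zip (enum I) J).
      by rewrite (size_special_zip r_gt0 Hv).
    by rewrite -(unzip1_zip sz); apply: (map_f fst H).
  have ij : (i, j) \in zip (enum I) J.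
    have sz : size (zip (enum I) J) <= size (take (r - e) (specials d r e V)).
      by rewrite (size_special_zip r_gt0 Hv).
    by rewrite -(unzip2_zip sz); apply: (map_f snd H).
  by apply: Or31; exists s, i, j.
- apply: Or32; case: (enumE_drop r_gt0 Hv) H => [[[a b] /= -> [[s t] /= Ed]]|[-> _]] //.
  have mem_d x : x \in [:: s; t] -> x \in V /\ x \in low n d.
    by rewrite -Ed => /mem_drop /mem_specials.
  have [|sV sl] := mem_d s; first by rewrite inE eqxx.
  have [|tV tl] := mem_d t; first by rewrite !inE eqxx orbT.
  by rewrite Ed inE => /eqP ->; exists s, a, b, t.
- case/mem_pair_up: H => x [y [-> ]]; rewrite !mem_enum !inE => /andP [_ xV] /andP [_ yV].
  by apply: Or33; exists x, y.
Qed.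

Lemma dir_block i j : (i, j) \in zip (enum I) J ->
  exists2 s, s \in low n d & [:: s; i; j] \in blocks d r e E I J V.
Proof.
move=> ij; have [s sin szip] := mem_zip_right (size_special_zip r_gt0 Hv) ij.
exists s; first by have /mem_take /mem_specials [] := sin.
rewrite mem_cat; apply/orP; left; exact: (map_f (fun q => [:: q.1; q.2.1; q.2.2]) szip).
Qed.

Lemma pair_block a b : enum E = [:: a; b] ->
  exists s t, [/\ s \in low n d, t \in low n d & [:: s; a; b; t] \in blocks d r e E I J V].
Proof.
move=> EE; case: (enumE_drop r_gt0 Hv) => [[[a' b'] /= E' [[s t] /= Ed]]|[E' _]];
  last by rewrite EE in E'.
have mem_d x : x \in [:: s; t] -> x \in low n d.
  by rewrite -Ed => /mem_drop /mem_specials [].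
exists s, t; split; first by apply: mem_d; rewrite inE eqxx.
  by apply: mem_d; rewrite !inE eqxx orbT.
by rewrite !mem_cat EE Ed inE eqxx orbT.
Qed.

Lemma own_good : all (good_block (codes A) (nat_edges L)) (map (map val) (blocks d r e E I J V)).
Proof.
apply/allP => _ /mapP [w /blocks_cases H ->].
have VA x : x \in V -> x \in A by rewrite inE => ->.
case: H => [[s [i [j [-> sV sl ij]]]]|[s [a [b [t [[-> sV sl tV tl] EE]]]]]|[x [y [-> xV yV]]]].
- have ijL : (i, j) \in L by rewrite mem_cat ij.
  have [[iI [jJ _]]|EE] := edges_cases Hv ijL; last first.
    have iE : i \in E by rewrite -mem_enum EE inE eqxx.
    have iI : i \in I.
      by rewrite -mem_enum -(unzip1_zip (s := enum I) (t := J)) ?(size_enumI Hv) //;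
        apply: (map_f fst ij).
    by case/(valid_I Hv): iI; rewrite iE.
  have iA : i \in A by rewrite !inE iI !orbT.
  have jA : j \in A = false.
    by have [_ /negPf H1 /negPf H2 /negPf H3] := valid_J Hv jJ; rewrite !inE H1 H2 H3.
  by rewrite good_block3 !omE !(joined_V _ sV) iA jA (VA _ sV) /joined ijL.
- have abL : (a, b) \in L by rewrite mem_cat EE inE eqxx orbT.
  have aE : a \in E by rewrite -mem_enum EE inE eqxx.
  have bE : b \in E by rewrite -mem_enum EE !inE eqxx orbT.
  have aA : a \in A by rewrite !inE aE orbT.
  have bA : b \in A by rewrite !inE bE orbT.
  rewrite good_block4 !omE (joinedC a t) (joinedC b t) !(joined_V _ sV) !(joined_V _ tV).
  by rewrite aA bA !VA // /joined abL.
- by rewrite good_block2 omE (joined_V _ xV) !VA.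
Qed.

Lemma card_support : #|used_letters E I J V| = #|V| + 2 * r.
Proof.
have := count_support Hv predT; rewrite !count_predT -!cardE => ->.
rewrite (valid_cardE Hv) (valid_cardI Hv) (valid_sizeJ Hv).
by case: (e) => /=; lia.
Qed.

Lemma touched_support x : (val x \in codes A) || touched (nat_edges L) (val x) ->
  x \in used_letters E I J V.
Proof.
case/orP; first by rewrite [_ \in _]codesE !inE => /or3P [] ->; rewrite ?orbT.
case/hasP => _ /mapP [[a b] /edges_mem [_ [aS bS]] ->] /=.
by case/orP => /eqP /val_inj <-.
Qed.

End Own.
End SignData.

(** * Recovering a datum from a nonvanishing evaluation *)

Section Separation.
Variables (n d r : nat).
Local Notation T := 'I_n.
Variables (e e' : bool) (E I V E' I' V' : {set T}) (J J' : seq T).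
Hypotheses (r_gt0 : 0 < r) (Hv : valid d r e E I J V) (Hv' : valid d r e' E' I' J' V').
Hypothesis good_all :
  all (good_block (codes (odd_letters E I V)) (nat_edges (edges E I J)))
      (map (map val) (blocks d r e' E' I' J' V')).
Hypothesis card_le : #|used_letters E I J V| <= #|used_letters E' I' J' V'|.
Local Notation A := (odd_letters E I V).
Local Notation joined := (joined E I J).

Let good w : w \in blocks d r e' E' I' J' V' ->
  good_block (codes A) (nat_edges (edges E I J)) (map val w).
Proof. by move=> wB; apply: (allP good_all); apply: map_f. Qed.

(** Every letter of a nonvanishing block is odd or on an edge for the first datum, which gives one
    inclusion; [card_le] gives equality. *)
Lemma sep_support : used_letters E I J V = used_letters E' I' J' V'.
Proof.
apply/esym/eqP; rewrite eqEcard card_le andbT; apply/fintype.subsetP => x.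
rewrite -(mem_blocks r_gt0 Hv') => /flattenP [w wB xw].
apply: (touched_support Hv); apply: (good_block_support _ (good wB)).
  case: (blocks_cases r_gt0 Hv' wB).
  - by move=> [s [i [j [-> _ _ _]]]].
  - by move=> [s [a [b [t [[-> _ _ _ _] _]]]]].
  - by move=> [y [z [-> _ _]]].
exact: map_f.
Qed.

(** Equal supports give equal sizes of [V], whose parity determines [e]. *)
Lemma sep_e : e = e'.
Proof.
have : #|V| + 2 * r = #|V'| + 2 * r.
  by rewrite -(card_support r_gt0 Hv) sep_support (card_support r_gt0 Hv').
move=> /addIn EV; have := valid_oddV Hv'; rewrite -EV (valid_oddV Hv) !oddD => /addbI.
by case: (e); case: (e').
Qed.

Lemma sep_dir i j : (i, j) \in zip (enum I') J' -> i \in A /\ joined i j.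
Proof.
move=> /(dir_block r_gt0 Hv') [s sl /good H].
exact: (good3E Hv sl H).
Qed.

Lemma sep_pair a b : enum E' = [:: a; b] -> [/\ a \in A, b \in A & joined a b].
Proof.
move=> /(pair_block r_gt0 Hv') [s [t [sl tl /good H]]].
exact: (good4E Hv sl tl H).
Qed.

Lemma joined_cases x y : joined x y ->
  [\/ x \in I /\ (x, y) \in zip (enum I) J, x \in J /\ y \in I | x \in E /\ y \in E].
Proof.
case/orP => /(edges_cases Hv) [[H1 [H2 H3]]|EE].
- by apply: Or31.
- by apply: Or33; rewrite -!(mem_enum E) EE !inE !eqxx orbT.
- by apply: Or32.
- by apply: Or33; rewrite -!(mem_enum E) EE !inE !eqxx orbT.
Qed.

Lemma notA_J x : x \in J -> x \notin A.
Proof. by case/(valid_J Hv) => _ nE nI nV; rewrite !inE !negb_or nE nI nV. Qed.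

(** The two letters of [E'] are odd and joined, while an edge between [I] and [J] has a head that is
    not odd. *)
Lemma sep_E : E = E'.
Proof.
have cE := valid_cardE Hv; have := valid_cardE Hv'; rewrite -sep_e => cE'.
apply/esym/eqP; rewrite eqEcard cE cE' leqnn andbT; apply/fintype.subsetP => x.
rewrite -mem_enum => xE'.
have [a [b EE]] : exists a b, enum E' = [:: a; b].
  move: cE' xE'; rewrite cardE; case: (e); case: (enum E') => [|a [|b [|]]] //= _ _.
  by exists a, b.
have [aA bA] := sep_pair EE.
case/joined_cases=> [[_ H]|[aJ _]|[aE bE]].
- have bJ : b \in J.
    by rewrite -(unzip2_zip (s := enum I) (t := J)) ?(size_enumI Hv) //; apply: (map_f snd H).
  by rewrite (negPf (notA_J bJ)) in bA.
- by rewrite (negPf (notA_J aJ)) in aA.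
- by move: xE'; rewrite EE !inE => /orP [] /eqP ->.
Qed.

Lemma zip_mem_I i : i \in I' -> exists j, (i, j) \in zip (enum I') J'.
Proof.
rewrite -mem_enum -{1}(unzip1_zip (s := enum I') (t := J')) ?(size_enumI Hv') //.
by case/mapP => [[i' j] H ->]; exists j.
Qed.

(** Oddness of [i] fixes the direction of the edge; the edge [E] is excluded because [I'] avoids E'
    = E. *)
Lemma dir_in_I i j : (i, j) \in zip (enum I') J' -> i \in I /\ (i, j) \in zip (enum I) J.
Proof.
move=> ij; have [iA] := sep_dir ij.
case/joined_cases=> [//|[iJ _]|[iE _]].
  by rewrite (negPf (notA_J iJ)) in iA.
have iI' : i \in I'.
  by rewrite -mem_enum -(unzip1_zip (s := enum I') (t := J')) ?(size_enumI Hv') //;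
    apply: (map_f fst ij).
by have [_] := valid_I Hv' iI'; rewrite -sep_E iE.
Qed.

Lemma sep_I : I = I'.
Proof.
apply/esym/eqP; rewrite eqEcard (valid_cardI Hv) (valid_cardI Hv') sep_e leqnn andbT.
by apply/fintype.subsetP => i /zip_mem_I [j /dir_in_I []].
Qed.

(** Both zips start from the same repetition-free enumeration, so an inclusion of pairs forces
    equality position by position. *)
Lemma sep_J : J = J'.
Proof.
have sz := size_enumI Hv; have sz' := size_enumI Hv'.
apply/esym; case EJ: J' => [|x0 s']; first by apply/esym/size0nil; rewrite -sz sep_I sz' EJ.
rewrite -EJ {EJ s'}; apply: (@eq_from_nth _ x0); first by rewrite -sz' -sz sep_I.
move=> l ls; have li : l < size (enum I') by rewrite sz'.
have mem : (nth x0 (enum I') l, nth x0 J' l) \in zip (enum I') J'.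
  by rewrite -nth_zip // mem_nth // size1_zip ?sz'.
have [_ /(nthP (x0, x0)) [l']] := dir_in_I mem.
rewrite size1_zip ?sz // => l'I; rewrite nth_zip // => -[E1 <-].
congr nth; apply/eqP; rewrite eq_sym -(nth_uniq x0 _ _ (enum_uniq I)) //.
- by rewrite E1 sep_I.
- by rewrite sep_I.
- by rewrite sz.
Qed.

Lemma sep_V : V = V'.
Proof.
have VU (F K W : {set T}) (s : seq T) f : valid d r f F K s W ->
    W = used_letters F K s W :\: (F :|: (K :|: [set x in s])).
  move=> Hw; apply/setP => x; rewrite !inE; case: (boolP (x \in W)) => xW.
    rewrite orTb andbT; apply/esym/negP => /or3P [].
    - by case/(valid_E Hw) => _ _ _; rewrite xW.
    - by case/(valid_I Hw) => _ _ _; rewrite xW.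
    - by case/(valid_J Hw) => _ _ _; rewrite xW.
  by case: (_ || _).
by rewrite (VU _ _ _ _ _ Hv) (VU _ _ _ _ _ Hv') sep_support sep_E sep_I sep_J.
Qed.

End Separation.

(** * Size of the family *)

Lemma card_pairs_ge (T1 T2 : finType) (P : pred T1) (Q : T1 -> pred T2) c q :
  (forall a, P a -> q <= c * #|Q a|) ->
  #|P| * q <= c * #|[pred x : T1 * T2 | P x.1 && Q x.1 x.2]|.
Proof.
move=> H; have -> : #|[pred x : T1 * T2 | P x.1 && Q x.1 x.2]| =
    \sum_(a | P a) \sum_(b | Q a b) 1 by rewrite pair_big_dep sum1_card.
rewrite -sum_nat_const big_distrr /=; apply: leq_sum => a Pa.
by rewrite sum1_card; apply: H.
Qed.

Section ParityCount.
Variable T : finType.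
Implicit Types (C L V : {set T}).

(** Toggling a fixed element of [C] exchanges the even and the odd subsets. *)
Lemma card_odd_subsets C o : 0 < #|C| ->
  2 * #|[set V : {set T} | (V \subset C) && (odd #|V| == o)]| = 2 ^ #|C|.
Proof.
case/card_gt0P => c cC.
pose f (V : {set T}) := [set x | (x \in V) (+) (x == c)].
have fK : involutive f by move=> V; apply/setP => x; rewrite !inE -addbA addbb addbF.
have odd_f V : odd #|f V| = ~~ odd #|V|.
  rewrite (cardsD1 c) (cardsD1 c V) !inE eqxx addbT !oddD.
  have -> : f V :\ c = V :\ c.
    by apply/setP => x; rewrite !inE; case: eqP => //= _; rewrite addbF.
  by case: (c \in V) => /=; case: (odd _).
have sub_f V : (f V \subset C) = (V \subset C).
  apply/fintype.subsetP/fintype.subsetP => H x xV.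
    have [->//|xc] := eqVneq x c; apply: H; by rewrite inE xV (negPf xc).
  by move: xV; rewrite inE; have [->//|xc] := eqVneq x c; rewrite addbF => /H.
pose S p := [set V : {set T} | (V \subset C) && (odd #|V| == p)].
have S_f p : #|S p| = #|S (~~ p)|.
  rewrite -(card_imset _ (inv_inj fK)); apply: eq_card => V.
  apply/imsetP/idP => [[W]|]; rewrite inE.
    by move=> /andP [WC /eqP Wp] ->; rewrite inE sub_f odd_f WC Wp eqxx.
  move=> /andP [VC /eqP Vp]; exists (f V); last by rewrite fK.
  by rewrite inE sub_f odd_f VC Vp negbK eqxx.
have -> : 2 ^ #|C| = #|S o| + #|S (~~ o)|.
  rewrite -card_powerset -(cardsID [set V : {set T} | odd #|V| == o]).
  congr (_ + _); apply: eq_card => V; rewrite !inE //.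
  by rewrite andbC; case: (odd _); case: o.
by rewrite -S_f mul2n addnn.
Qed.

Lemma card_small_subsets L r : 0 < #|L| ->
  #|[set S : {set T} | (S \subset L) && (#|S| <= r)]| <= r.+1 * #|L| ^ r.
Proof.
move=> L0; rewrite -sum1_card.
rewrite (partition_big (fun S : {set T} => inord #|S| : 'I_r.+1) predT) //=.
rewrite -[X in _ <= X * _]card_ord -sum_nat_const; apply: leq_sum => i _.
rewrite sum1_card.
apply: (@leq_trans #|[set S : {set T} | (S \subset L) && (#|S| == i)]|).
  apply: subset_leq_card; apply/fintype.subsetP => S; rewrite unfold_in !inE.
  move=> /andP [/andP [SL Sr] /eqP <-].
  by rewrite SL inordK ?ltnS ?eqxx.
rewrite cards_draws.
have le_bin a b : 'C(a, b) <= a ^ b.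
  rewrite -(leq_pmul2r (fact_gt0 b)) bin_ffact.
  have : a ^_ b <= a ^ b.
    elim: b a => [|b IH] a; first by rewrite ffactn0.
    case: a => [|a]; first by rewrite ffact0n.
    rewrite ffactSS expnS leq_mul2l /=; apply: leq_trans (IH a) _.
    by case: b {IH} => [|b] //; rewrite leq_exp2r.
  by move=> H; apply: leq_trans H _; rewrite leq_pmulr ?fact_gt0.
apply: leq_trans (le_bin _ _) _; rewrite leq_pexp2l //; exact: leq_ord.
Qed.

(** Half of the subsets have the right parity, and at most 1/12 of all subsets meet [L] too little:
    1/2 - 1/12 = 5/12. *)
Lemma card_good_subsets C L r o : L \subset C -> 0 < #|C| ->
  12 * #|[set S : {set T} | (S \subset L) && (#|S| <= r)]| <= 2 ^ #|L| ->
  5 * 2 ^ #|C| <=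
  12 * #|[set V : {set T} | [&& V \subset C, odd #|V| == o & r < #|V :&: L|]]|.
Proof.
move=> LC C0 HB; set B := [set S | _] in HB; set G := [set V | _].
have Cp := card_odd_subsets o C0; set P := [set V | _] in Cp.
pose Bad := [set V : {set T} | (V \subset C) && (#|V :&: L| <= r)].
have PGB : #|P| <= #|G| + #|Bad|.
  apply: leq_trans (leq_card_setU G Bad); apply: subset_leq_card.
  by apply/fintype.subsetP => V; rewrite !inE => /andP [-> ->]; case: ltnP.
have HBad : #|Bad| <= #|B| * 2 ^ (#|C| - #|L|).
  have -> : #|C| - #|L| = #|C :\: L| by rewrite cardsD (finset.setIidPr LC).
  rewrite -card_powerset -cardsX.
  have inj : injective (fun V : {set T} => (V :&: L, V :\: L)).
    by move=> V W [E1 E2]; rewrite -(finset.setID V L) E1 E2 finset.setID.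
  rewrite -(card_imset _ inj); apply: subset_leq_card; apply/fintype.subsetP => p /imsetP [V].
  rewrite inE => /andP [VC Vr] ->; rewrite !inE /= Vr finset.subsetIr /=.
  by apply: finset.setSD.
have : 12 * #|Bad| <= 2 ^ #|C|.
  rewrite -(subnKC (subset_leq_card LC)) expnD.
  apply: leq_trans (leq_mul HB (leqnn _)); rewrite -mulnA leq_mul2l; exact: HBad.
by move: PGB Cp; move: #|P| #|G| #|Bad| (2 ^ _) => p g b c; lia.
Qed.

End ParityCount.

Lemma exp_beats_poly a r : exists2 d, 0 < d & a * d ^ r <= 2 ^ d.
Proof.
(* With d = 2^c it is enough that a + cr <= 2^c, which follows from (s + 1)^3 <= 2^(3s). *)
pose s := a + r; pose c := 3 * s; exists (2 ^ c); first by rewrite expn_gt0.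
rewrite -expnM; apply: (@leq_trans (2 ^ a * 2 ^ (c * r))).
  by rewrite leq_mul2r (ltnW (ltn_expl a _)) ?orbT.
rewrite -expnD leq_exp2l //.
have E : s < 2 ^ s by apply: ltn_expl.
have : s.+1 * s.+1 * s.+1 <= 2 ^ c.
  have -> : 2 ^ c = 2 ^ s * 2 ^ s * 2 ^ s by rewrite -!expnD; congr (2 ^ _); lia.
  by rewrite !leq_mul.
have : a + c * r <= s.+1 * s.+1 * s.+1 by rewrite /c /s; nia.
exact: leq_trans.
Qed.

Lemma ffactD m a b : m ^_ (a + b) = m ^_ a * (m - a) ^_ b.
Proof.
elim: a m => [|a IH] m; first by rewrite subn0 mul1n.
by rewrite addSn !ffactnS IH mulnA; congr (_ * _ ^_ _); lia.
Qed.

Section Counting.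
Variables (n d r : nat).
Hypotheses (r_gt0 : 0 < r) (dn : d + 2 * r < n).
Hypothesis d_large : 12 * (r.+1 * d ^ r) <= 2 ^ d.
Hypothesis d_gt0 : 0 < d.
Local Notation T := 'I_n.

Definition datum (e : bool) : Type :=
  ({set T} * {set T} * (r - e).-tuple T * {set T})%type.

Definition valid_datum (e : bool) : pred (datum e) :=
  fun x => valid d r e x.1.1.1 x.1.1.2 x.1.2 x.2.

Lemma card_low : #|low n d| = d.
Proof.
have dn' : d <= n by lia.
have inj : injective (widen_ord dn') by move=> x y /(congr1 val) /= /val_inj.
rewrite -[RHS]card_ord -(card_imset _ inj).
apply: eq_card => x; rewrite inE; apply/idP/imsetP => [xd|[y _ ->]]; last exact: ltn_ord y.
by exists (Ordinal xd) => //; apply: val_inj.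
Qed.

(** [E], [I], [J] and [V] are chosen in turn: the first three outside [low], the last among the n -
    2r letters left, where [card_good_subsets] supplies the fraction 5/12. *)
Lemma card_valid (e : bool) :
  ('C(n - d, 2 * e) * 'C(n - d - 2 * e, r - e) * (n - d - 2 * e - (r - e)) ^_ (r - e)) *
    (5 * 2 ^ (n - 2 * r)) <= 12 * #|[pred x : datum e | valid_datum x]|.
Proof.
pose P1 (E : {set T}) := (E \subset ~: low n d) && (#|E| == 2 * e).
pose P2 (E I : {set T}) := (I \subset ~: low n d :\: E) && (#|I| == r - e).
pose P3 (x : {set T} * {set T}) (J : (r - e).-tuple T) :=
  all [in ~: low n d :\: x.1 :\: x.2] J && uniq J.
pose P4 (x : {set T} * {set T} * (r - e).-tuple T) (V : {set T}) :=
  [&& V \subset ~: (x.1.1 :|: (x.1.2 :|: [set y in x.2])), odd #|V| == odd (r + e)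
    & r < #|V :&: low n d|].
have cl : #|~: low n d| = n - d by rewrite cardsCs finset.setCK card_ord card_low.
have c1 : #|P1| = 'C(n - d, 2 * e).
  by rewrite -cl -cards_draws; apply: eq_card => E; rewrite !inE.
have c2 E : P1 E -> 'C(n - d - 2 * e, r - e) <= 1 * #|P2 E|.
  move=> /andP [sE /eqP cE]; rewrite mul1n.
  have <- : #|~: low n d :\: E| = n - d - 2 * e.
    by rewrite cardsD (finset.setIidPr sE) cl cE.
  by rewrite -cards_draws; apply: subset_leq_card; apply/fintype.subsetP => I; rewrite !inE.
have c3 x : P1 x.1 && P2 x.1 x.2 ->
    (n - d - 2 * e - (r - e)) ^_ (r - e) <= 1 * #|P3 x|.
  move=> /andP [/andP [sE /eqP cE] /andP [sI /eqP cI]]; rewrite mul1n.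
  have <- : #|~: low n d :\: x.1 :\: x.2| = n - d - 2 * e - (r - e).
    by rewrite cardsD (finset.setIidPr sI) cI cardsD (finset.setIidPr sE) cl cE.
  rewrite -card_uniq_tuples; apply: subset_leq_card; apply/fintype.subsetP => t.
  by rewrite !inE.
have c4 x : (P1 x.1.1 && P2 x.1.1 x.1.2) && P3 x.1 x.2 ->
    5 * 2 ^ (n - 2 * r) <= 12 * #|P4 x|.
  case: x => [[E I] J] /=.
  move=> /andP [/andP [/andP [/= sE /eqP cE] /andP [/= sI /eqP cI]] /andP [/= sJ UJ]].
  set C := ~: (E :|: (I :|: [set y in J])).
  have LC : low n d \subset C.
    apply/fintype.subsetP => y yl; rewrite !inE; apply/negP => /or3P [yE|yI|yJ].
    - by have := fintype.subsetP sE _ yE; rewrite inE yl.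
    - by have := fintype.subsetP sI _ yI; move: yl; rewrite !inE => ->; rewrite !andbF.
    - by have := allP sJ _ yJ; move: yl; rewrite !inE => ->; rewrite !andbF.
  have cC : #|C| = n - 2 * r.
    rewrite cardsCs finset.setCK card_ord; congr (_ - _).
    have -> : #|E :|: (I :|: [set y in J])| = #|E| + (#|I| + #|[set y in J]|).
      rewrite !cardsU.
      have -> : I :&: [set y in J] = finset.set0.
        apply/setP => y; rewrite !inE; apply/negP => /andP [yI yJ].
        by have := allP sJ _ yJ; rewrite !inE yI.
      have -> : E :&: (I :|: [set y in J]) = finset.set0.
        apply/setP => y; rewrite !inE; apply/negP => /andP [yE /orP [yI|yJ]].
          by have := fintype.subsetP sI _ yI; rewrite !inE yE.
        by have := allP sJ _ yJ; rewrite !inE yE andbF.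
      by rewrite !finset.cards0 !subn0.
    rewrite cE cI cardsE (card_uniqP UJ) size_tuple.
    by case: (e) => /=; lia.
  have C0 : 0 < #|C| by rewrite cC; lia.
  have HB : 12 * #|[set S : {set T} | (S \subset low n d) && (#|S| <= r)]| <= 2 ^ #|low n d|.
    rewrite card_low; apply: leq_trans d_large; rewrite leq_mul2l /=.
    have := @card_small_subsets _ (low n d) r.
    by rewrite card_low => /(_ d_gt0).
  have := card_good_subsets (odd (r + e)) LC C0 HB; rewrite cC => H.
  apply: leq_trans H _; rewrite leq_mul2l /=; apply: subset_leq_card.
  by apply/fintype.subsetP => V; rewrite !inE.
have h1 := card_pairs_ge c2; have h2 := card_pairs_ge c3; have h3 := card_pairs_ge c4.
rewrite !mul1n in h1 h2.
apply: leq_trans (leq_trans _ h3) _.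
  rewrite leq_mul2r; apply/orP; right; apply: leq_trans h2; rewrite leq_mul2r; apply/orP; right.
  by apply: leq_trans h1; rewrite c1.
rewrite leq_mul2l /=; apply: subset_leq_card; apply/fintype.subsetP => -[[[E I] J] V].
rewrite !inE /= /P1 /P2 /P3 /P4 /valid_datum /valid /=.
move=> /andP [/andP [/andP [-> ->] /andP [-> ->]] ->].
by rewrite size_tuple eqxx.
Qed.

(** The binomials times (2e)! (r - e)! make a falling factorial, and (2e)! (r - e)! <= r! because r
    >= 2. *)
Lemma card_valid_fact (e : bool) : 1 < r ->
  n - d >= 2 * r -> (n - d) ^_ (2 * r) * (5 * 2 ^ (n - 2 * r)) <=
  r`! * (12 * #|[pred x : datum e | valid_datum x]|).
Proof.
move=> r_gt1 le_r; set N := #|_|; have := card_valid e; rewrite -/N.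
set m := n - d in le_r *; set q := 5 * _ => H.
have E : 'C(m, 2 * e) * 'C(m - 2 * e, r - e) * (m - 2 * e - (r - e)) ^_ (r - e) *
    ((2 * e)`! * (r - e)`!) = m ^_ (2 * r).
  have -> : 2 * r = 2 * e + (r - e) + (r - e) by case: (e) => /=; lia.
  rewrite (ffactD m (2 * e + (r - e))) (ffactD m (2 * e)) subnDA mulnAC.
  rewrite -(bin_ffact m) -(bin_ffact (m - 2 * e)).
  by rewrite mulnACA.
have F : (2 * e)`! * (r - e)`! <= r`!.
  case: (e); last by rewrite muln0 subn0 mul1n.
  have -> : (2 * true)`! = 2 by [].
  case: r r_gt1 => // r' r1; rewrite subSS subn0 factS leq_mul2r.
  by apply/orP; right.
rewrite -E; apply: leq_trans (leq_mul F H); set a := _ * _ ^_ _; set b := _ * _`!.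
by rewrite mulnAC [b * _]mulnC.
Qed.

End Counting.

Section LowerBound.
Variables (K : fieldType) (n d r : nat).
Hypothesis charK : ([pchar K] =i pred0)%R.
Hypotheses (r_gt1 : 1 < r) (dn : d + 2 * r < n).
Hypothesis d_large : 12 * (r.+1 * d ^ r) <= 2 ^ d.
Hypothesis d_gt0 : 0 < d.

Let r_gt0 : 0 < r := ltnW r_gt1.

Definition datum_letters e (x : datum n r e) : pred nat :=
  codes (odd_letters x.1.1.1 x.1.1.2 x.2).
Definition datum_edges e (x : datum n r e) : seq (nat * nat) :=
  nat_edges (edges x.1.1.1 x.1.1.2 x.1.2).
Definition datum_prefix e (x : datum n r e) : seq nat :=
  map val (prefix_letters x.1.1.1 x.1.1.2 x.1.2 x.2).
Definition datum_blocks e (x : datum n r e) : seq (seq nat) :=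
  map (map val) (blocks d r e x.1.1.1 x.1.1.2 x.1.2 x.2).

Lemma datum_sep e e' (x : datum n r e) (y : datum n r e') :
  valid_datum d x -> valid_datum d y ->
  all (good_block (datum_letters x) (datum_edges x)) (datum_blocks y) ->
  size (flatten (datum_blocks x)) <= size (flatten (datum_blocks y)) ->
  [/\ e = e', x.1.1.1 = y.1.1.1, x.1.1.2 = y.1.1.2, x.1.2 = y.1.2 :> seq _ & x.2 = y.2].
Proof.
move=> vx vy good; rewrite !size_blocks // => le_xy; split.
- exact: sep_e r_gt0 vx vy good le_xy.
- exact: sep_E r_gt0 vx vy good le_xy.
- exact: sep_I r_gt0 vx vy good le_xy.
- exact: sep_J r_gt0 vx vy good le_xy.
- exact: sep_V r_gt0 vx vy good le_xy.
Qed.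

Lemma card_valid_le_codim :
  #|[pred x : datum n r false | valid_datum d x]| +
  #|[pred x : datum n r true | valid_datum d x]| <= nilp_codim K (2 * r + 2) n.
Proof.
pose X e := {x : datum n r e | valid_datum d x}.
have -> : #|[pred x : datum n r false | valid_datum d x]| +
    #|[pred x : datum n r true | valid_datum d x]| = #|{: X false + X true}|.
  by rewrite card_sum !card_sig.
pose A (s : X false + X true) := match s with
  inl x => datum_letters (sval x) | inr x => datum_letters (sval x) end.
pose M (s : X false + X true) := match s with
  inl x => datum_edges (sval x) | inr x => datum_edges (sval x) end.
pose pre (s : X false + X true) := match s with
  inl x => datum_prefix (sval x) | inr x => datum_prefix (sval x) end.
pose vs (s : X false + X true) := match s with
  inl x => datum_blocks (sval x) | inr x => datum_blocks (sval x) end.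
apply: (codim_family charK (A := A) (M := M) (pre := pre) (vs := vs)).
- by case=> [[x vx]|[x vx]]; rewrite /= size_map (size_edges r_gt0 vx).
- by case=> [[x vx]|[x vx]]; apply: perm_blocks r_gt0 vx.
- by case=> [[x vx]|[x vx]]; apply: own_good r_gt0 vx.
have inj e (x y : datum n r e) : x.1.1.1 = y.1.1.1 -> x.1.1.2 = y.1.1.2 ->
    x.1.2 = y.1.2 :> seq _ -> x.2 = y.2 -> x = y.
  by move: x y => [[[E I] J] V] [[[E' I'] J'] V'] /= -> -> /val_inj -> ->.
case=> [[x vx]|[x vx]] [[y vy]|[y vy]] good le_xy;
  have [//= _ E1 E2 E3 E4] := datum_sep vx vy good le_xy.
- congr inl; apply: val_inj; exact: (inj false x y E1 E2 E3 E4).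
- congr inr; apply: val_inj; exact: (inj true x y E1 E2 E3 E4).
Qed.

(** Both values of [e] satisfy the same bound, so adding them turns the factor 12 into 6. *)
Lemma codim_lower : 5 * 2 ^ (n - 2 * r) * (n - d) ^_ (2 * r) <=
  6 * r`! * nilp_codim K (2 * r + 2) n.
Proof.
have le_r : n - d >= 2 * r by lia.
have h0 := card_valid_fact r_gt0 dn d_large d_gt0 false r_gt1 le_r.
have h1 := card_valid_fact r_gt0 dn d_large d_gt0 true r_gt1 le_r.
have : 12 * r`! * (#|[pred x : datum n r false | valid_datum d x]| +
  #|[pred x : datum n r true | valid_datum d x]|) <= 12 * r`! * nilp_codim K (2 * r + 2) n.
  by rewrite leq_mul2l card_valid_le_codim orbT.
move: h0 h1; set a := _ ^_ _; set b := 2 ^ _; set f := r`!; set c := nilp_codim _ _ _.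
set u := #|_|; set v := #|_|.
nia.
Qed.

End LowerBound.

Local Open Scope ring_scope.

(** * The polynomial lower bound *)

Lemma ffact_ge_exp m t : ((m - t) ^ t <= m ^_ t)%N.
Proof.
elim: t m => [|t IH] m; first by rewrite ffactn0.
rewrite expnS ffactnS leq_mul ?leq_subr //.
by apply: leq_trans (IH _); rewrite -subn1 subnAC -subnDA addn1.
Qed.

(** Bernoulli's inequality for (1 - c/x)^t, cleared of denominators. *)
Lemma bernoulli_shift (x c : rat) t : 0 <= c <= x ->
  x ^+ t * (x - t%:R * c) <= x * (x - c) ^+ t.
Proof.
move=> /andP [c0 cx]; elim: t => [|t IH]; first by rewrite !expr0 mul0r subr0 mul1r mulr1.
rewrite [in leRHS]exprSr mulrA; apply: le_trans (ler_wpM2r _ IH); last by rewrite subr_ge0.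
rewrite exprSr -!mulrA ler_wpM2l ?exprn_ge0 //; first exact: le_trans cx.
rewrite -subr_ge0 -natr1.
have -> : (x - t%:R * c) * (x - c) - x * (x - (t%:R + 1) * c) = t%:R * (c * c) by ring.
by rewrite !mulr_ge0.
Qed.

Lemma bin_le_exp2 n m : ('C(n, m) <= 2 ^ n)%N.
Proof.
elim: n m => [|n IH] [|m]; rewrite ?bin0 ?expn_gt0 //.
by rewrite binS expnS mul2n -addnn leq_add.
Qed.

(** The constants come from 6 (4^r / 2 + 4^r * 4/5) = 4^r * 39/5, where the second summand bounds
    the Catalan number. *)
Lemma fact_double_ge r : (3 <= r)%N -> (39 * 4 ^ r * r`! <= 25 * (2 * r)`!)%N.
Proof.
elim: r => // r IH; rewrite leq_eqVlt => /orP [/eqP <- //|r3].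
have {}IH := IH r3.
rewrite expnS factS (_ : 2 * r.+1 = (2 * r).+2)%N ?factS; last lia.
move: IH; set a := (4 ^ r)%N; set b := r`!; set c := (2 * r)`! => IH.
have : (4 * r.+1 * (39 * a * b) <= (2 * r).+2 * (2 * r).+1 * (25 * c))%N.
  by apply: leq_mul => //; nia.
by clearbody a b c; nia.
Qed.

Section PolynomialBound.
Variable K : fieldType.
Hypothesis charK : [pchar K] =i pred0.

(* Any polynomial with leading coefficient at most that of the counting bound works,
   once it is made nonpositive for small n by its linear factor. *)
Lemma codim_poly_lower r (kappa : rat) : (1 < r)%N -> 0 < kappa ->
  6 * kappa * r`!%:R <= 5 * (2 * r)`!%:R ->
  exists R : {poly rat}, [/\ size R = (2 * r).+1,
    lead_coef R = kappa / (2 ^+ (2 * r) * (2 * r)`!%:R) &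
    forall n, 2 ^+ n * R.[n%:R] <= (nilp_codim K (2 * r + 2) n)%:R].
Proof.
move=> r1 k0 Hk; have [d d0 Hd] := exp_beats_poly (12 * r.+1) r.
rewrite -mulnA in Hd.
(* Each of the t factors of the falling factorial is at least n - (d + t), and Bernoulli's
   inequality turns this into the single shift [n1]. *)
pose t := (2 * r)%N; pose n1 := (t * (d + t))%N.
pose a := kappa / (2 ^+ t * t`!%:R).
have t0 : (0 < t)%N by rewrite /t; lia.
have f0 : 0 < t`!%:R :> rat by rewrite ltr0n fact_gt0.
have p0 m : 0 < 2 ^+ m :> rat by rewrite exprn_gt0.
have a0 : 0 < a by rewrite divr_gt0 // mulr_gt0.
exists (a *: ('X^(t.-1) * ('X - n1%:R%:P))); split.
- rewrite size_scale ?gt_eqF // size_Mmonic ?monicXsubC //; last first.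
    by rewrite -size_poly_eq0 size_polyXn.
  by rewrite size_polyXn size_XsubC addn2 /= prednK.
- rewrite lead_coefZ lead_coef_Mmonic ?monicXsubC // lead_coefXn mulr1 //.
move=> n; rewrite hornerZ hornerM hornerXn hornerXsubC.
have [le_n|lt_n] := leqP n n1.
  apply: le_trans (ler0n _ _).
  rewrite pmulr_rle0 // pmulr_rle0 // mulr_ge0_le0 ?exprn_ge0 //.
  by rewrite subr_le0 ler_nat.
have dn : (d + 2 * r < n)%N.
  apply: leq_ltn_trans lt_n; rewrite -/t /n1; apply: leq_pmull; exact: t0.
have lb := codim_lower charK r1 dn Hd d0; rewrite -/t in lb dn.
have dt0 : 0 <= ((d + t)%:R : rat) <= n%:R by rewrite ler0n ler_nat ltnW.
have n0 : 0 < n%:R :> rat by rewrite ltr0n; lia.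
have B : n%:R ^+ t.-1 * (n%:R - n1%:R) <= ((n - d) ^_ t)%:R :> rat.
  have := @bernoulli_shift _ _ t dt0; rewrite -natrM -{1}(prednK t0) exprS -mulrA ler_pM2l //.
  move=> H; apply: le_trans H _; rewrite -natrB ?(ltnW dn) // -natrX ler_nat subnDA.
  exact: ffact_ge_exp.
have C : 2 ^+ n * a = kappa / t`!%:R * 2 ^+ (n - t).
  rewrite -{1}(@subnK t n); last by lia.
  rewrite exprD /a; field; rewrite !gt_eqF //.
rewrite mulrA C -(mulrA (kappa / _)).
apply: (@le_trans _ _ (kappa / t`!%:R * (2 ^+ (n - t) * ((n - d) ^_ t)%:R))).
  apply: ler_wpM2l; first by rewrite ltW // divr_gt0.
  by apply: ler_wpM2l; first exact: ltW.
have g0 : 0 < 6 * r`!%:R :> rat by rewrite mulr_gt0 // ltr0n fact_gt0.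
have D : kappa / t`!%:R <= 5 / (6 * r`!%:R).
  by rewrite ler_pdivrMr // mulrAC ler_pdivlMr // mulrA [kappa * 6]mulrC.
apply: le_trans (ler_wpM2r _ D) _; first by rewrite mulr_ge0 ?ler0n // ltW.
rewrite mulrAC ler_pdivrMr // mulrA.
by move: lb; rewrite -(ler_nat rat) !natrM natrX [X in _ -> _ <= X]mulrC.
Qed.

End PolynomialBound.

Theorem corollary3p12 (K : fieldType) (charK : [pchar K] =i pred0)
    (k : nat) (k_ge3 : (3 <= k)%N) :
  [/\ exists R S : {poly rat},
        [/\ size R = (2 * k - 2).+1,
            (size S <= (2 * k - 1).+1)%N,
            (4 <= k)%N ->
              lead_coef R =
                (2 ^+ (2 * k - 3) + catalan k)
                / (2 ^+ (2 * k - 2) * ((2 * k - 2)`!)%:R),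
            k = 3%N ->
              lead_coef R =
                (2 ^+ (2 * k - 3) + catalan (k - 1))
                / (2 ^+ (2 * k - 2) * ((2 * k - 2)`!)%:R)
          & forall n : nat, (2 * k + 1 <= n)%N ->
              (nilp_codim K (2 * k) n <= nilp_codim K (2 * k + 1) n)%N /\
              2 ^+ n * R.[n%:R] + S.[n%:R] <= (nilp_codim K (2 * k) n)%:R],
      forall n : nat, (n <= 2 * k)%N ->
        [/\ nilp_codim K (2 * k + 1) n = nilp_codim K (2 * k) n,
            nilp_codim K (2 * k) n = lmdim (multilin K n)
          & lmdim (multilin K n) = n`!]
    & forall n : nat, (2 * k + 1 <= n <= 4 * k)%N ->
        (nilp_codim K (2 * k) n < nilp_codim K (2 * k + 1) n)%N].
Proof.
rewrite addn1; have k2 : (2 * k)%N = (2 * k).-1.+1 by lia.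
split.
- pose c : rat := if k == 3%N then catalan (k - 1) else catalan k.
  pose r := (k - 1)%N; have Er : (2 * k - 2 = 2 * r)%N by rewrite /r; lia.
  have cat0 m : 0 <= catalan m by rewrite divr_ge0 ?ler0n.
  have kappa0 : 0 < 2 ^+ (2 * k - 3) + c.
    by rewrite ltr_wpDr ?exprn_gt0 // /c; case: ifP.
  have Hk : 6 * (2 ^+ (2 * k - 3) + c) * r`!%:R <= 5 * (2 * r)`!%:R.
    rewrite /c /r; case: (eqVneq k 3%N) => [->|k3].
      (* The Catalan number is 2 here, and both sides equal 120. *)
      rewrite /catalan; have -> : 'C(2 * (3 - 1), 3 - 1) = 6%N by [].
      have -> : (3 - 1)`! = 2%N by [].
      have -> : (3 - 1).+1 = 3%N by [].
      have -> : (2 * (3 - 1))`! = 24%N by [].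
      by have -> : (2 * 3 - 3)%N = 3%N by []; lra.
    have k4 : (4 <= k)%N by lia.
    have F : 39 * 4 ^+ r * r`!%:R <= 25 * (2 * r)`!%:R :> rat.
      have : (39 * 4 ^ r * r`! <= 25 * (2 * r)`!)%N 
        by apply: fact_double_ge; rewrite /r; lia.
      by rewrite -(ler_nat rat) !natrM natrX.
    (* The central binomial coefficient is at most 4^k, and k + 1 >= 5. *)
    have Ck : catalan k <= 4 ^+ r * 4 / 5.
      rewrite /catalan ler_pdivrMr ?ltr0n // mulrAC ler_pdivlMr //.
      apply: (@le_trans _ _ (4 ^+ k * 5)).
        rewrite ler_pM2r // (_ : 4 = 2 ^+ 2) // -exprM -natrX ler_nat.
        exact: bin_le_exp2.
      have -> : k = r.+1 by rewrite /r; lia.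
      rewrite exprSr ler_pM2l ?mulr_gt0 ?exprn_gt0 // (ler_nat _ 5); lia.
    have E2 : 2 ^+ (2 * k - 3) = 4 ^+ r / 2 :> rat.
      have -> : (2 * k - 3 = (2 * r).-1)%N by rewrite /r; lia.
      apply: (@mulIf _ 2) => //; rewrite divfK // -exprSr prednK ?/r; last by lia.
      by rewrite (_ : 4 = 2 ^+ 2) // -exprM.
    have v0 : 0 <= r`!%:R :> rat by rewrite ler0n.
    move: (ler_wpM2r v0 Ck) F; rewrite E2 -/r.
    by move: (4 ^+ r) (r`!%:R) (catalan k) ((2 * r)`!%:R) => u v w y; lra.
  have [||//|R [szR lcR HR]] := @codim_poly_lower K charK r (2 ^+ (2 * k - 3) + c).
  + by rewrite /r; lia.
  + exact: kappa0.
  (* The negative lower-order terms of [R] already absorb every correction, so S = 0 suffices. *)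
  exists R, 0; rewrite Er; split.
  + exact: szR.
  + by rewrite size_poly0.
  + by move=> k4; rewrite lcR /c; case: eqP => // k3; rewrite k3 in k4.
  + by move=> k3; rewrite lcR /c k3.
  move=> n _; split; first exact: nilp_codim_le.
  by rewrite horner0 addr0; have -> : (2 * k = 2 * r + 2)%N by rewrite /r; lia.
- move=> n nk; rewrite lmdim_multilin; split=> //.
    by rewrite k2 !nilp_codim_low //; lia.
  by rewrite k2 nilp_codim_low // -k2.
by move=> n /andP [kn _]; apply: nilp_codim_step.
Qed.
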